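(* Let $(\Delta,\mathcal A)$ be a thick, affine, semi-discrete, ordered hovel such that $\mathbb A^v=(V,W^v)$ has no irreducible factor of affine type and such that $\Delta$ is not a tree. Let $G$ be a vectorially Weyl subgroup of $\mathrm{Aut}(\Delta)$ that acts strongly transitively on the twin building at infinity $\partial\Delta$ of $\Delta$ and satisfies condition (LST). Then $G$ contains a strongly regular hyperbolic element.
   Context: VECTORIAL DATA. $V$ is a finite dimensional real vector space, $I$ a finite non-empty set, $(\alpha_i)_{i\in I}$ a free family in $V^*$, $(\alpha_i^\vee)_{i\in I}$ a family in $V$ such that $\mathbb M=(\alpha_j(\alpha_i^\vee))_{i,j\in I}$ is a (possibly decomposable) generalized Cartan matrix. Put $r_i(v)=v-\alpha_i(v)\alpha_i^\vee$ and let $W^v\subset GL(V)$ be the group generated by the $r_i$. $\Phi=\{w(\alpha_i): w\in W^v,i\in I\}$ is the set of real roots; $\Phi_{im}\subset\bigoplus_i\mathbb Z\alpha_i\subset V^*$ is the set of imaginary roots of the Kac–Moody Lie algebra of $\mathbb M$. For $\alpha=w(\alpha_i)\in\Phi$, $\alpha^\vee=w(\alpha_i^\vee)$ and $r_\alpha(v)=v-\alpha(v)\alpha^\vee$. $C^v_f=\{v:\alpha_i(v)>0\ \forall i\}$. For $J\subset I$, $F^v(J)=\{v:\alpha_i(v)=0\ \forall i\in J,\ \alpha_i(v)>0\ \forall i\in I\setminus J\}$. Positive (negative) vectorial faces are the $w.F^v(J)$ (the $-w.F^v(J)$), $w\in W^v$; chambers if $J=\emptyset$, panels if $|J|=1$;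 spherical if $\langle r_i: i\in J\rangle$ is finite. $\mathcal T$ (resp. $\mathcal T^\circ$) is the union of all positive (resp. positive spherical) vectorial faces. MODEL APARTMENT. $\mathbb A$ is $V$ as an affine space with a set $\mathcal M$ of walls, hyperplanes of the form $M(\alpha,k)=\{v:\alpha(v)+k=0\}$, $\alpha\in\Phi$, $k\in\mathbb R$. Let $\Lambda_\alpha=\{k: M(\alpha,k)\in\mathcal M\}$ for $\alpha\in\Phi$ (assumed infinite and containing $0$), and $\Lambda_\alpha=\mathbb R$ for $\alpha\in\Phi_{im}$. $D(\alpha,k)=\{v:\alpha(v)+k\ge0\}$, $D(\alpha,\infty)=\mathbb A$; $D(\alpha,k)$ is a half-apartment if $\alpha\in\Phi$, $k\in\Lambda_\alpha$. $W^a$ is the group generated by the affine reflections $r_M$ in walls $M=M(\alpha,k)$ (with linear part $r_\alpha$ and fixed set $M$); it is assumed to stabilize $\mathcal M$. $\mathrm{Aut}(\mathbb A)$ is the group of affine bijections stabilizing the set of pairs $(M,\alpha^\vee)$ with $M=M(\alpha,k)$, $\alpha\in\Phi$, $k\in\Lambda_\alpha$. Write $x\le y$ if $y-x\in\mathcal T$ and $x\stackrel{o}{<}y$ if $y-x\in\mathcal T^\circ$. FILTERS. A filter is contained in a set $S$ if $S$ belongs to it; $F\subset F'$ for filters if every member of $F'$ is a member of $F$; a map fixes a filter pointwise if it fixes pointwise some member. $\mathrm{germ}_x(S)$ is the filter of subsets containing the intersection of $S$ with a neighbourhood of $x$. The enclosure $cl_{\mathbb A}(F)$ is the filter of subsets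 containing some member of $F$ of the form $\bigcap_{\alpha\in\Phi\cup\Phi_{im}}D(\alpha,k_\alpha)$, $k_\alpha\in\Lambda_\alpha\cup\{\infty\}$. The closure $\overline F$ is the filter of subsets containing the closure of a member of $F$. The support of $F$ is the smallest affine subspace containing it. Local face: $F^\ell(x,F^v)=\mathrm{germ}_x(x+F^v)$ ($x\in\mathbb A$, $F^v$ a vectorial face); local chamber (panel) if $F^v$ is a chamber (panel); closed face: enclosure of a local face. A local chamber $C$ contains (covers) a local face $F$ if $F\subset\overline C$. Sector-face: $\mathfrak f=x+F^v$, spherical if $F^v$ is; sector if $F^v$ is a chamber (base point $x$, direction $F^v$), sector-panel if $F^v$ is a panel; its germ is the filter of subsets containing a translate of $\mathfrak f$ by a vector of $F^v$. Chimney: $\mathfrak r(F,F^v)=cl_{\mathbb A}(F+F^v)$, $F$ a local face; splayed if $F^v$ is spherical; solid if (the direction of) its support has finite pointwise stabilizer in $W^v$; its germ is the filter of subsets containing $\mathfrak r(F+\xi,F^v)$ for some $\xi\in F^v$. A ray with origin $x$ containing $y\ne x$ (or interval $(x,y]$) is preordered if $x\le y$ or $y\le x$, generic if $x\stackrel{o}{<}y$ or $y\stackrel{o}{<}x$; the germ of $(x,y]$ is $\mathrm{germ}_x((x,y])$. HOVEL. An apartment of type $\mathbb A$ is a set $A$ with a set $Isom^w(\mathbb A,A)$ of bijections which is of the form $\{f_0\circ w: w\in W^a\}$. A bijection $\varphi:A\to A'$ of apartments is an isomorphism (resp. Weyl-isomorphism, vectorially Weyl-isomorphism) if $f'^{-1}\circ\varphi\circ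 f\in\mathrm{Aut}(\mathbb A)$ (resp. $W^a$, $(W^v\ltimes V)\cap\mathrm{Aut}(\mathbb A)$) for all $f\in Isom^w(\mathbb A,A)$, $f'\in Isom^w(\mathbb A,A')$. All notions above are transported to apartments. An affine ordered hovel of type $\mathbb A$ is a set $\Delta$ with a covering $\mathcal A$ by subsets (apartments) such that: (MA1) each $A\in\mathcal A$ has a structure of apartment of type $\mathbb A$; (MA2) if $F$ is a point, a germ of a preordered interval, a generic ray or a solid chimney in an apartment $A$ and $A'$ is another apartment containing $F$, then $A\cap A'\supset cl_A(F)$ and there is a Weyl-isomorphism $A\to A'$ fixing $cl_A(F)$ pointwise; (MA3) if $\mathfrak R$ is the germ of a splayed chimney and $F$ is a closed face or a germ of a solid chimney, some apartment contains $\mathfrak R$ and $F$; (MA4) if two apartments $A,A'$ contain such $\mathfrak R$ and $F$, then $A\cap A'\supset cl_A(\mathfrak R\cup F)$ and there is a Weyl-isomorphism $A\to A'$ fixing $cl_A(\mathfrak R\cup F)$ pointwise; (MAO) if $x,y\in A\cap A'$ and $x\le_A y$, then $[x,y]_A=[x,y]_{A'}$. $\mathrm{Aut}(\Delta)$ is the group of bijections $\varphi$ of $\Delta$ with $A\in\mathcal A\Leftrightarrow\varphi(A)\in\mathcal A$ and each $\varphi|_A:A\to\varphi(A)$ an isomorphism; $\varphi$ is vectorially Weyl if every $\varphi|_A$ is a vectorially Weyl-isomorphism. A vectorially Weyl subgroup is a subgroup of $\mathrm{Aut}(\Delta)$ consisting of vectorially Weyl-automorphisms. INFINITY. Two spherical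 sector-faces (or generic rays) are, up to shortening, contained in a common apartment; they are parallel if, there, one is a translate of the other. Parallel classes of generic rays are ideal points; parallel classes $\partial\mathfrak f$ of spherical sector-faces are ideal faces (chambers for sectors, panels for sector-panels). $\partial A$ denotes the set of ideal faces of sector-faces in $A$. The ideal faces of sign $\pm$ form buildings $\partial^\pm\Delta$ with Weyl group $W^v$, which are twinned: $\partial\Delta=\partial^+\Delta\sqcup\partial^-\Delta$, with twin apartments the $\partial A$, $A\in\mathcal A$. Two ideal faces are opposite if they are the classes in some apartment of sector-faces with directions $F^v$ and $-F^v$. An ideal point lies in (the interior of) an ideal chamber $c$ if it is the class of a ray contained in a sector of class $c$. FURTHER TERMS. $\Delta$ is semi-discrete if each $\Lambda_\alpha$, $\alpha\in\Phi$, is discrete in $\mathbb R$; thick if each local panel whose support is a wall is contained in at least 3 local chambers; not a tree means $\dim V\ge2$. An irreducible factor of affine type is an indecomposable component of $\mathbb M$ of affine type (in Kac's finite/affine/indefinite classification). Strong transitivity on $\partial\Delta$: $G$ is transitive on the twin apartments of $\partial\Delta$ and the stabilizer of a twin apartment $(A_-,A_+)$ is transitive on the chambers of $A_+$ (so also of $A_-$). Condition (LST): for a pair $(\sigma,\sigma')$ of opposite panels of $\partial\Delta$, let $P(\sigma,\sigma')$ be the union of all apartments whose boundaries contain $\sigma$ and $\sigma'$. It splits canonically as $T(\sigma,\sigma')\times\mathbb R^{n-1}$, $n=\dim V$, where $T(\sigma,\sigma')$ is a tree whose vertices $v$ correspond to the walls $\{v\}\times\mathbb R^{n-1}$ of $\Delta$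 in $P(\sigma,\sigma')$ containing $\sigma,\sigma'$ at infinity; its apartment system $\mathcal A(\sigma,\sigma')$ is the set of lines $D$ such that $D\times\mathbb R^{n-1}$ is an apartment of $\Delta$ with $\sigma,\sigma'$ in its boundary. $G$ satisfies (LST) if, for every such pair, the stabilizer $G_{\sigma,\sigma'}$ of $\sigma$ and $\sigma'$ acts strongly transitively on $(T(\sigma,\sigma'),\mathcal A(\sigma,\sigma'))$, i.e. transitively on $\mathcal A(\sigma,\sigma')$ and such that the stabilizer of a line $D\in\mathcal A(\sigma,\sigma')$ is transitive on the edges of $D$. Strongly regular elements: a line $\ell$ in an apartment $A$ (for its affine structure) is strongly regular if its two points at infinity lie in the interior of two opposite chambers of $\partial\Delta$ (so both associated ray germs are generic, and $A$ is the unique apartment containing $\ell$). An element $\gamma\in\mathrm{Aut}(\Delta)$ is a strongly regular hyperbolic element if there is an apartment $A$ and a strongly regular line $\ell\subset A$ which is a translation axis of $\gamma$, i.e. $\gamma(\ell)=\ell$ and $\gamma$ acts on $\ell$ as a non-trivial translation. *)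

(* Defs.v *)
From HB Require Import structures.
From mathcomp Require Import all_boot all_order all_algebra complex.
From mathcomp Require Import all_classical all_reals all_analysis.
Set Implicit Arguments.
Unset Strict Implicit.
Unset Printing Implicit Defensive.
Import Order.TTheory GRing.Theory Num.Theory.
Import numFieldNormedType.Exports.
Local Open Scope classical_set_scope.
Local Open Scope ring_scope.

Inductive gen_group (T : Type) (S : set (T -> T)) : set (T -> T) :=
| gen_id : gen_group S id
| gen_in f : S f -> gen_group S f
| gen_comp f g : gen_group S f -> gen_group S g -> gen_group S (f \o g)
| gen_inv f g : gen_group S f -> cancel f g -> cancel g f -> gen_group S g.

(* Kac's g(A) = g~(A)/tau, with tau the largest ideal of g~(A) meeting h
   trivially.  [km_h], [km_coroot], [km_root] form a realization of A; being
   generated by h, the e_i, the f_i and satisfying the relations of g~(A) makes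
   [km_g] a quotient of g~(A); injectivity of [km_in] and [km_max] say that the
   kernel is exactly tau. *)
Record km_algebra (K : fieldType) (I : finType) (A : I -> I -> K) := KM {
  km_h : vectType K;
  km_coroot : I -> km_h;
  km_root : I -> 'Hom(km_h, K^o);
  km_coroot_free : free (codom km_coroot);
  km_root_free : free (codom km_root);
  km_pairing : forall i j, km_root j (km_coroot i) = A i j;
  km_dim : (\dim {:km_h} +
    \rank (\matrix_(i < #|I|, j < #|I|) A (enum_val i) (enum_val j)))%N
    = (2 * #|I|)%N;
  km_g : lmodType K;
  km_br : km_g -> km_g -> km_g;
  km_br_linl : forall c x y z,
    km_br (c *: x + y) z = c *: km_br x z + km_br y z;
  km_br_linr : forall c x y z,
    km_br z (c *: x + y) = c *: km_br z x + km_br z y;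
  km_br_alt : forall x, km_br x x = 0;
  km_jacobi : forall x y z,
    km_br x (km_br y z) + km_br y (km_br z x) + km_br z (km_br x y) = 0;
  km_in : {linear km_h -> km_g};
  km_e : I -> km_g;
  km_f : I -> km_g;
  km_rel_ef : forall i j, km_br (km_e i) (km_f j) =
    if i == j then km_in (km_coroot i) else 0;
  km_rel_hh : forall h h', km_br (km_in h) (km_in h') = 0;
  km_rel_he : forall h i, km_br (km_in h) (km_e i) = km_root i h *: km_e i;
  km_rel_hf : forall h i, km_br (km_in h) (km_f i) = - (km_root i h *: km_f i);
  km_gen : forall S : set km_g,
    (forall h, S (km_in h)) -> (forall i, S (km_e i)) ->
    (forall i, S (km_f i)) ->
    (forall c x y, S x -> S y -> S (c *: x + y)) ->
    (forall x y, S x -> S y -> S (km_br x y)) ->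
    forall x, S x;
  km_in_inj : injective km_in;
  km_max : forall J : set km_g,
    J 0 -> (forall c x y, J x -> J y -> J (c *: x + y)) ->
    (forall x y, J y -> J (km_br x y)) ->
    (forall h, J (km_in h) -> km_in h = 0) ->
    forall x, J x -> x = 0
}.

Definition is_km_root (K : fieldType) (I : finType) (A : I -> I -> K)
    (g : km_algebra A) (b : 'Hom(km_h g, K^o)) :=
  b != 0 /\
  exists2 x : km_g g, x != 0 & forall h, km_br (km_in g h) x = b h *: x.

Record vect_data (R : realType) (V : vectType R) (I : finType) := VectData {
  sroot : I -> 'Hom(V, R^o);
  scoroot : I -> V;
  index_nonempty : (0 < #|I|)%N;
  sroot_free : free (codom sroot);
  gcm_diag : forall i, sroot i (scoroot i) = 2;
  gcm_off : forall i j, i != j ->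
    exists n : nat, sroot j (scoroot i) = - (n%:R);
  gcm_sym : forall i j, sroot j (scoroot i) = 0 -> sroot i (scoroot j) = 0
}.

Section VectorialData.
Variables (R : realType) (V : vectType R) (I : finType) (D : vect_data V I).

Definition cartan (i j : I) : R := sroot D j (scoroot D i).

Definition srefl (i : I) (v : V) : V := v - sroot D i v *: scoroot D i.

Definition Wv : set (V -> V) := gen_group (range srefl).

(* [root_pair a av]: for some w in W^v and i in I, a = w(alpha_i) (that is,
   a o w = alpha_i) and av = w(alpha_i^vee). *)
Definition root_pair (a : 'Hom(V, R^o)) (av : V) :=
  exists w i, [/\ Wv w, forall v, a (w v) = sroot D i v & av = w (scoroot D i)].

Definition real_root (a : 'Hom(V, R^o)) := exists av, root_pair a av.

(* The roots of the complex Kac-Moody algebra lie in the lattice spanned by the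
   simple roots; they are transported to V^* along km_root i |-> sroot i. *)
Definition imag_root (b : 'Hom(V, R^o)) :=
  ~ real_root b /\
  exists (g : km_algebra (fun i j => ((cartan i j)%:C)%C)) (n : I -> int),
    is_km_root (\sum_i km_root g i *~ n i) /\ b = \sum_i sroot D i *~ n i.

Definition face0 (J : {set I}) : set V :=
  [set v | forall i, if i \in J then sroot D i v = 0 else 0 < sroot D i v].

(* Vectorial faces of type J; s = true for positive, s = false for negative. *)
Definition vface (s : bool) (J : {set I}) (F : set V) :=
  exists2 w, Wv w & F = [set (if s then w v else - w v) | v in face0 J].

Definition is_vface (F : set V) := exists s J, vface s J F.

Definition spherical (J : {set I}) :=
  finite_set (gen_group [set srefl i | i in [set` J]]).

Definition sph_vface (F : set V) := exists s J, vface s J F /\ spherical J.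

Definition Tits : set V := [set v | exists2 F, (exists J, vface true J F) & F v].
Definition Tits_o : set V :=
  [set v | exists2 F, (exists2 J, spherical J & vface true J F) & F v].

Definition vle (x y : V) := Tits (y - x).
Definition vlt_o (x y : V) := Tits_o (y - x).

(* Indecomposable components: connected components of the Dynkin graph. *)
Definition component (J : {set I}) :=
  exists i, J = [set j | connect (fun k l => cartan k l != 0) i j]%SET.

Definition comp_mx (J : {set I}) : 'M[R]_#|J| :=
  \matrix_(i, j) cartan (enum_val i) (enum_val j).

(* Kac's type (Aff). *)
Definition affine_type (n : nat) (A : 'M[R]_n) :=
  [/\ (\rank A).+1 = n,
      exists2 u : 'cV[R]_n, (forall i, 0 < u i 0) & A *m u = 0 &
      forall v : 'cV[R]_n, (forall i, 0 <= (A *m v) i 0) -> A *m v = 0].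

Definition no_affine_factor :=
  forall J, component J -> ~ affine_type (comp_mx J).

Definition trans (x : V) (S : set V) : set V := [set x + v | v in S].

(* The usual topology of V, through coordinates in a basis. *)
Definition vnbhs (x : V) : set_system V :=
  [set U | exists2 e : R, 0 < e &
    forall y, (forall i, `|coord (vbasis {:V}) i (y - x)| < e) -> U y].

Definition vclosure (S : set V) : set V :=
  [set x | forall U, vnbhs x U -> exists2 y, U y & S y].

Definition germ (x : V) (S : set V) : set_system V :=
  [set T | exists2 U, vnbhs x U & U `&` S `<=` T].

Definition fclosure (F : set_system V) : set_system V :=
  [set T | exists2 S, F S & vclosure S `<=` T].

Definition local_face (x : V) (Fv : set V) : set_system V :=
  germ x (trans x Fv).

Definition faff (x : V) (U : {vspace V}) : set V := trans x [set` U].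

(* The support of F is x + U. *)
Definition is_support (F : set_system V) (x : V) (U : {vspace V}) :=
  F (faff x U) /\ forall y U', F (faff y U') -> faff x U `<=` faff y U'.

Definition vseg (x y : V) : set V :=
  [set z | exists t : R, [/\ 0 <= t, t <= 1 & z = x + t *: (y - x)]].
Definition vseg_open_left (x y : V) : set V :=
  [set z | exists t : R, [/\ 0 < t, t <= 1 & z = x + t *: (y - x)]].
Definition vray (x u : V) : set V :=
  [set z | exists2 t : R, 0 <= t & z = x + t *: u].
Definition vline (x u : V) : set V :=
  [set z | exists t : R, z = x + t *: u].

Definition preordered_germ (F : set_system V) :=
  exists x y, [/\ x <> y, vle x y \/ vle y x & F = germ x (vseg_open_left x y)].

(* Rays and lines directed by u are generic. *)
Definition generic_dir (u : V) := u <> 0 /\ (vlt_o 0 u \/ vlt_o u 0).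

Definition hyp (a : 'Hom(V, R^o)) (k : R) : set V := [set v | (a v : R) + k = 0].

Definition hrefl (a : 'Hom(V, R^o)) (av : V) (k : R) (v : V) : V :=
  v - ((a v : R) + k) *: av.

Definition Waff (walls : set (set V)) : set (V -> V) :=
  gen_group [set g : V -> V | exists a av k,
    [/\ root_pair a av, walls (hyp a k) & g = hrefl a av k]].

End VectorialData.

Record model_apartment (R : realType) (V : vectType R) (I : finType)
    (D : vect_data V I) := ModelApartment {
  walls : set (set V);
  walls_hyp : forall M, walls M ->
    exists a k, real_root D a /\ M = hyp a k;
  walls_infinite : forall a, real_root D a ->
    infinite_set [set k | walls (hyp a k)];
  walls0 : forall a, real_root D a -> walls (hyp a 0);
  walls_stable : forall w M, Waff D walls w -> walls M -> walls (w @` M)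
}.

Section ModelApartment.
Variables (R : realType) (V : vectType R) (I : finType) (D : vect_data V I).
Variable X : model_apartment D.

Definition Lam (a : 'Hom(V, R^o)) : set R := [set k | walls X (hyp a k)].

Definition semi_discrete := forall a, real_root D a -> Lam a `<=` isolated (Lam a).

Definition Wa : set (V -> V) := Waff D (walls X).

(* Affine bijections g(v) = L(v) + b stabilizing the set of pairs
   (M(a,k), a^vee). *)
Definition wall_coroot (M : set V) (av : V) :=
  exists a k, [/\ root_pair D a av, Lam a k & M = hyp a k].

Definition AutA : set (V -> V) :=
  [set g : V -> V | bijective g /\ exists (L : 'End(V)) (b : V),
    (forall v, g v = L v + b) /\
    (forall M av, wall_coroot M av <-> wall_coroot (g @` M) (L av))].

Definition AutA_vw : set (V -> V) :=
  [set g : V -> V | AutA g /\ exists w b, Wv D w /\ forall v, g v = w v + b].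

(* The value +oo of k encodes D(a,oo) = A. *)
Definition enclosed_set (k : 'Hom(V, R^o) -> \bar R) : set V :=
  [set v | forall a, real_root D a \/ imag_root D a ->
                     (0 <= (a v : R)%:E + k a)%E].

Definition admissible (k : 'Hom(V, R^o) -> \bar R) :=
  forall a, (real_root D a -> k a = +oo%E \/ exists2 r, Lam a r & k a = r%:E) /\
            (imag_root D a -> k a = +oo%E \/ exists r : R, k a = r%:E).

Definition cl (F : set_system V) : set_system V :=
  [set S | exists k, [/\ admissible k, F (enclosed_set k) &
                         enclosed_set k `<=` S]].

Definition closed_face (F : set_system V) :=
  exists x Fv, is_vface D Fv /\ F = cl (local_face x Fv).

Definition fadd (F : set_system V) (Fv : set V) : set_system V :=
  [set S | exists2 T, F T & [set t + v | t in T & v in Fv] `<=` S].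

Definition ftrans (xi : V) (F : set_system V) : set_system V :=
  [set S | exists2 T, F T & trans xi T `<=` S].

Definition chimney (F : set_system V) (Fv : set V) : set_system V :=
  cl (fadd F Fv).

Definition chimney_germ (F : set_system V) (Fv : set V) : set_system V :=
  [set S | exists2 xi, Fv xi & chimney (ftrans xi F) Fv S].

Definition solid (C : set_system V) :=
  exists x U, is_support C x U /\
    finite_set [set w : V -> V | Wv D w /\ forall u, u \in U -> w u = u].

Definition solid_chimney (C : set_system V) :=
  exists x Fv0 Fv, [/\ is_vface D Fv0, is_vface D Fv,
    C = chimney (local_face x Fv0) Fv & solid C].

Definition solid_chimney_germ (C : set_system V) :=
  exists x Fv0 Fv, [/\ is_vface D Fv0, is_vface D Fv,
    solid (chimney (local_face x Fv0) Fv) &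
    C = chimney_germ (local_face x Fv0) Fv].

Definition splayed_chimney_germ (C : set_system V) :=
  exists x Fv0 Fv, [/\ is_vface D Fv0, sph_vface D Fv &
    C = chimney_germ (local_face x Fv0) Fv].

Definition MA2_filter (F : set_system V) :=
  [\/ exists x, F = globally [set x],
      preordered_germ D F,
      exists x u, generic_dir D u /\ F = globally (vray x u) |
      solid_chimney F].

End ModelApartment.

(* isomw A is the set Isom^w(A_model, A) of a structure of apartment on A, as
   bijections V -> A.  As usual for buildings, Delta is not empty. *)
Record apt_system (R : realType) (V : vectType R) (I : finType)
    (D : vect_data V I) (X : model_apartment D) (Delta : Type) := AptSystem {
  apts : set (set Delta);
  isomw : set Delta -> set (V -> Delta);
  apt_nonempty : inhabited Delta;
  apt_cover : forall x, exists2 A, apts A & A x;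
  apt_MA1 : forall A, apts A -> exists2 f0, set_bij setT A f0 &
    isomw A = [set f0 \o w | w in Wa X]
}.

Section Hovel.
Variables (R : realType) (V : vectType R) (I : finType) (D : vect_data V I).
Variables (X : model_apartment D) (Delta : Type) (H : apt_system X Delta).
Implicit Types (A : set Delta) (F : set_system Delta) (f : V -> Delta).

Definition chart A f := apts H A /\ isomw H A f.

(* Isomorphisms A -> A' are represented by maps of Delta, of which only the
   restriction to A matters; K is AutA, Wa or AutA_vw. *)
Definition apt_iso (K : set (V -> V)) A A' (phi : Delta -> Delta) :=
  set_bij A A' phi /\
  forall f f', isomw H A f -> isomw H A' f' ->
    exists2 w, K w & forall v, phi (f v) = f' (w v).

Definition fixes (phi : Delta -> Delta) F :=
  exists2 S, F S & forall x, S x -> phi x = x.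

Definition in_apt (P : set_system V -> Prop) A F :=
  exists f (F0 : set_system V), [/\ chart A f, P F0 & F = fmap f F0].

Definition cl_apt A F : set_system Delta :=
  [set S | exists2 f, isomw H A f & cl X [set T | F (f @` T)] (f @^-1` S)].

Definition le_apt A (x y : Delta) :=
  exists f v w, [/\ isomw H A f, x = f v, y = f w & vle D v w].

Definition seg_apt A (x y : Delta) : set Delta :=
  [set z | exists f v w, [/\ isomw H A f, x = f v, y = f w & (f @` vseg v w) z]].

Definition MA2 := forall A A' F,
  apts H A -> apts H A' -> in_apt (MA2_filter X) A F -> F A' ->
  cl_apt A F (A `&` A') /\
  exists2 phi, apt_iso (Wa X) A A' phi & fixes phi (cl_apt A F).

Definition MA34_filters (Rg F : set_system Delta) :=
  (exists A, in_apt (splayed_chimney_germ X) A Rg) /\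
  (exists A, in_apt (closed_face X) A F \/ in_apt (solid_chimney_germ X) A F).

Definition MA3 := forall Rg F,
  MA34_filters Rg F -> exists2 A, apts H A & Rg A /\ F A.

Definition MA4 := forall Rg F A A',
  MA34_filters Rg F -> apts H A -> apts H A' ->
  Rg A -> F A -> Rg A' -> F A' ->
  cl_apt A (Rg `&` F) (A `&` A') /\
  exists2 phi, apt_iso (Wa X) A A' phi & fixes phi (cl_apt A (Rg `&` F)).

Definition MAO := forall A A' x y, apts H A -> apts H A' ->
  (A `&` A') x -> (A `&` A') y -> le_apt A x y -> seg_apt A x y = seg_apt A' x y.

Definition ordered_affine_hovel := [/\ MA2, MA3, MA4 & MAO].

Definition covers (C F : set_system Delta) :=
  exists A f s x Fv, [/\ chart A f, vface D s finset.set0 Fv,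
    C = fmap f (local_face x Fv) &
    fmap f (fclosure (local_face x Fv)) `<=` F].

Definition thick := forall A f s J x Fv y U,
  chart A f -> vface D s J Fv -> #|J| = 1%N ->
  is_support (local_face x Fv) y U -> walls X (faff y U) ->
  exists C1 C2 C3, [/\ C1 <> C2, C1 <> C3, C2 <> C3 &
    [/\ covers C1 (fmap f (local_face x Fv)),
        covers C2 (fmap f (local_face x Fv)) &
        covers C3 (fmap f (local_face x Fv))]].

Definition sector_face A (s : bool) (J : {set I}) (S : set Delta) :=
  exists f x Fv, [/\ chart A f, vface D s J Fv & S = f @` trans x Fv].

Definition sph_sector_face (S : set Delta) :=
  exists A s J, spherical D J /\ sector_face A s J S.

Definition sf_shortening (S S' : set Delta) :=
  exists A f x Fv xi, [/\ chart A f, is_vface D Fv, Fv xi,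
    S = f @` trans x Fv & S' = f @` trans (x + xi) Fv].

Definition generic_ray (S : set Delta) :=
  exists A f x u, [/\ chart A f, generic_dir D u & S = f @` vray x u].

Definition ray_shortening (S S' : set Delta) :=
  exists A f x u (t : R), [/\ chart A f, generic_dir D u, 0 <= t,
    S = f @` vray x u & S' = f @` vray (x + t *: u) u].

Definition parallel (short : set Delta -> set Delta -> Prop)
    (S1 S2 : set Delta) :=
  exists A f S1' S2' u, [/\ chart A f, short S1 S1' /\ short S2 S2',
    S1' `<=` A /\ S2' `<=` A & f @^-1` S2' = trans u (f @^-1` S1')].

(* An ideal face (ideal point) is encoded as the set of all spherical
   sector-faces (generic rays) of its parallel class. *)
Definition bface (S : set Delta) : set (set Delta) :=
  [set S' | sph_sector_face S' /\ parallel sf_shortening S S'].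

Definition bpoint (S : set Delta) : set (set Delta) :=
  [set S' | generic_ray S' /\ parallel ray_shortening S S'].

Definition bd_type A (s : bool) (J : {set I}) : set (set (set Delta)) :=
  [set c | exists2 S, sector_face A s J S & c = bface S].

(* The half of sign s of the twin apartment of A. *)
Definition bd A (s : bool) : set (set (set Delta)) :=
  [set c | exists2 J, spherical D J & bd_type A s J c].

Definition opposite (J : {set I}) (c c' : set (set Delta)) :=
  exists A f s Fv x y, [/\ chart A f, spherical D J, vface D s J Fv,
    c = bface (f @` trans x Fv) &
    c' = bface (f @` trans y [set - v | v in Fv])].

(* The ray directed by u lies in the open chamber, so that p is in the interior
   of c (an open sector also contains rays directed by the walls of c). *)
Definition in_interior (p c : set (set Delta)) :=
  exists A f x s Fv u, [/\ chart A f, vface D s finset.set0 Fv, Fv u,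
    c = bface (f @` trans x Fv) & p = bpoint (f @` vray x u)].

Definition AutD (phi : Delta -> Delta) :=
  [/\ bijective phi, forall A, apts H A <-> apts H (phi @` A) &
      forall A, apts H A -> apt_iso (AutA X) A (phi @` A) phi].

Definition vect_weyl_aut (phi : Delta -> Delta) :=
  AutD phi /\ forall A, apts H A -> apt_iso (AutA_vw X) A (phi @` A) phi.

Definition vect_weyl_subgroup (G : set (Delta -> Delta)) :=
  [/\ G id, forall g h, G g -> G h -> G (g \o h),
      forall g, G g -> exists2 h, G h & cancel g h /\ cancel h g &
      forall g, G g -> vect_weyl_aut g].

Definition bact (g : Delta -> Delta) (c : set (set Delta)) : set (set Delta) :=
  [set g @` S | S in c].

Definition strongly_transitive_bd (G : set (Delta -> Delta)) :=
  (forall A A', apts H A -> apts H A' ->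
     exists2 g, G g & forall s, [set bact g c | c in bd A s] = bd A' s) /\
  (forall A c c', apts H A ->
     bd_type A true finset.set0 c -> bd_type A true finset.set0 c' ->
     exists g, [/\ G g, forall s, [set bact g c | c in bd A s] = bd A s &
                        bact g c = c']).

Definition opposite_panels (c c' : set (set Delta)) :=
  exists2 J : {set I}, #|J| = 1%N & opposite J c c'.

Definition bd_contains A (c : set (set Delta)) := exists s, bd A s c.

Section Tree.
Variables sg sg' : set (set Delta).

Definition tree_apt A := [/\ apts H A, bd_contains A sg & bd_contains A sg'].

Definition at_infinity (L : set Delta) :=
  (exists2 S, sg S & S `<=` L) /\ (exists2 S, sg' S & S `<=` L).

(* A point t of the tree T(sg,sg') is encoded by its fibre {t} x R^(n-1) in
   P(sg,sg'): a subset of an apartment A whose boundary contains sg and sg',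
   parallel to the hyperplanes of A with sg and sg' at infinity. *)
Definition fibre A (L : set Delta) :=
  tree_apt A /\ at_infinity L /\
  exists f a (t : R), [/\ isomw H A f, real_root D a & L = f @` hyp a t].

(* The line D with D x R^(n-1) = A. *)
Definition tree_line A : set (set Delta) := [set L | fibre A L].

Definition tree_lines : set (set (set Delta)) :=
  [set tree_line A | A in tree_apt].

(* The (closed) edges of the line of A: segments between two consecutive
   vertices, i.e. consecutive walls of A. *)
Definition tree_edge A (E : set (set Delta)) :=
  tree_apt A /\
  exists f a (k l : R),
    [/\ isomw H A f, real_root D a, at_infinity (f @` hyp a k),
        [/\ Lam X a k, Lam X a l, k < l &
            forall m, Lam X a m -> ~ (k < m /\ m < l)] &
        E = [set f @` hyp a t | t in [set t | k <= t /\ t <= l]]].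

Definition edge_of (Dl E : set (set Delta)) :=
  exists A, Dl = tree_line A /\ tree_edge A E.

Definition panel_stab (G : set (Delta -> Delta)) : set (Delta -> Delta) :=
  [set g | [/\ G g, bact g sg = sg & bact g sg' = sg']].

Definition strongly_transitive_tree (G : set (Delta -> Delta)) :=
  (forall Dl Dl', tree_lines Dl -> tree_lines Dl' ->
     exists2 g, panel_stab G g & bact g Dl = Dl') /\
  (forall Dl E E', tree_lines Dl -> edge_of Dl E -> edge_of Dl E' ->
     exists g, [/\ panel_stab G g, bact g Dl = Dl & bact g E = E']).

End Tree.

Definition LST (G : set (Delta -> Delta)) :=
  forall sg sg', opposite_panels sg sg' -> strongly_transitive_tree sg sg' G.

Definition strongly_regular_line f (x u : V) :=
  exists c c', [/\ opposite finset.set0 c c',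
    in_interior (bpoint (f @` vray x u)) c &
    in_interior (bpoint (f @` vray x (- u))) c'].

Definition strongly_regular_hyperbolic (g : Delta -> Delta) :=
  AutD g /\
  exists A f x u, [/\ chart A f, u <> 0, strongly_regular_line f x u,
    g @` (f @` vline x u) = f @` vline x u &
    exists2 s : R, s <> 0 &
      forall t : R, g (f (x + t *: u)) = f (x + (t + s) *: u)].

End Hovel.

(* Main.v *)
Require Import Defs.
From mathcomp Require Import all_boot all_order all_algebra.
From mathcomp Require Import all_classical all_reals all_analysis.
From mathcomp Require Import zify ring lra.
Local Open Scope classical_set_scope.
Local Open Scope ring_scope.
Set Implicit Arguments.
Unset Strict Implicit.
Unset Printing Implicit Defensive.
Import Order.TTheory GRing.Theory Num.Theory.
Import numFieldNormedType.Exports.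

(* Fix a chart of an apartment [A] and let [T] be the group of translations of
   [A] induced by elements of [G].
   - An apartment is determined by its boundary: it is the enclosure of the germs
     of any two opposite sectors in it, so (MA4) applies.  Hence strong
     transitivity at infinity yields, for each [i], an element of [G] stabilizing
     [A] with linear part [r_i]; in particular [T] is stable under [r_i].
   - For the panel of type [i] and its opposite in [A], (LST) yields elements of
     [G] stabilizing [A] and the panel and moving a strip between consecutive
     walls arbitrarily far.  Their linear parts stabilize the panel, so they are
     1 or [r_i] by Tits' theorem on fundamental chambers; composing two of them if
     necessary, [T] contains some [t] with [alpha_i t != 0], and hence
     [t - r_i t], a nonzero multiple of [alpha_i^vee].
   - Without affine factors, some real combination of the coroots is in the open
     fundamental chamber: otherwise Gordan's alternative gives [y >= 0], [y != 0]
     with [M y = 0], and the support of [y] contains an affine component.  By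
     rounding, [T] meets the open chamber, and a translation by such a vector is
     strongly regular hyperbolic.
   Linear parts are compared inside a third apartment along sector-faces lying on
   walls: for these the enclosure of the sector-face involves only simple roots, so
   no knowledge of the imaginary roots is needed. *)

(** * Words in the simple reflections *)

Section WeylGroup.
Variables (R : realType) (V : vectType R) (I : finType) (D : vect_data V I).
Implicit Types (s t : seq I) (i j : I) (v : V).

Lemma srefl_lin i c u v :
  srefl D i (c *: u + v) = c *: srefl D i u + srefl D i v.
Proof.
rewrite /srefl linearP scalerBr addrACA -opprD scalerDl; congr (_ - (_ + _)).
by rewrite scalerA.
Qed.

Lemma srefl_root i v : (sroot D i (srefl D i v) : R) = - sroot D i v.
Proof. by rewrite /srefl linearB linearZ /= gcm_diag /GRing.scale /=; ring. Qed.

Lemma sreflK i : involutive (srefl D i).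
Proof. by move=> v; rewrite {1}/srefl srefl_root /srefl scaleNr opprK subrK. Qed.

Definition act s v := foldr (srefl D) v s.

Lemma act_cat s t v : act (s ++ t) v = act s (act t v).
Proof. by rewrite /act foldr_cat. Qed.

Lemma act_rcons s i v : act (rcons s i) v = act s (srefl D i v).
Proof. by rewrite -cats1 act_cat. Qed.

Lemma act_lin s c u v : act s (c *: u + v) = c *: act s u + act s v.
Proof. by elim: s => //= i s ->; rewrite srefl_lin. Qed.

Lemma act_revK s : cancel (act s) (act (rev s)).
Proof.
by elim: s => //= i s IH v; rewrite rev_cons act_rcons sreflK IH.
Qed.

Lemma act_Krev s : cancel (act (rev s)) (act s).
Proof. by move=> v; rewrite -{1}(revK s) act_revK. Qed.

Lemma act_rev_eq s t : act s =1 act t -> act (rev s) =1 act (rev t).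
Proof. by move=> e v; rewrite -{1}(act_Krev t v) -e act_revK. Qed.

(** The generators are involutions, so reversed words supply the inverses. *)
Lemma gen_act (J : set I) w :
  gen_group [set srefl D i | i in J] w <->
  exists2 s, (forall i, i \in s -> J i) & w = act s.
Proof.
split=> [|[s sJ ->]]; last first.
  elim: s sJ => [|i s IH] sJ; first exact: gen_id.
  apply: (gen_comp (f := srefl D i)).
    by apply: gen_in; exists i => //; apply: sJ; rewrite inE eqxx.
  by apply: IH => j js; apply: sJ; rewrite inE js orbT.
elim=> [|f [i Ji <-]|f g _ [s sJ ->] _ [t tJ ->]|f g _ [s sJ ->] fg gf].
- by exists [::].
- by exists [:: i] => // j; rewrite inE => /eqP ->.
- exists (s ++ t); last by apply/funext => v; rewrite act_cat.
  by move=> i; rewrite mem_cat => /orP[/sJ|/tJ].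
- exists (rev s) => [i|]; first by rewrite mem_rev => /sJ.
  by apply/funext => v; rewrite -{2}(gf v) act_revK.
Qed.

Lemma WvE w : Wv D w <-> exists s, w = act s.
Proof.
rewrite /Wv; split=> [/gen_act[s _ ->]|[s ->]]; first by exists s.
by apply/gen_act; exists s.
Qed.

(** Length is measured through the action on [V], so no abstract Coxeter group has to be compared
    with [Wv]. *)
Definition reduced s := forall t, act t =1 act s -> (size s <= size t)%N.

Lemma reduced_word s : exists2 t, reduced t & act t =1 act s.
Proof.
pose P n := `[< exists2 t, size t = n & act t =1 act s >].
have ex : exists n, P n by exists (size s); apply/asboolP; exists s.
case: (ex_minnP ex) => n /asboolP[t tn ts] nmin; exists t => // t' t's.
rewrite tn; apply: nmin; apply/asboolP; exists t' => // v.
by rewrite t's ts.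
Qed.

(** * Alternating words and rank two *)

Fixpoint alt n i j := if n is n'.+1 then i :: alt n' j i else [::].

Lemma size_alt n i j : size (alt n i j) = n.
Proof. by elim: n i j => //= n IH i j; rewrite IH. Qed.

Lemma alt_rcons n i j : alt n.+1 i j = rcons (alt n i j) (if odd n then j else i).
Proof.
elim: n i j => // n IH i j; have -> : alt n.+2 i j = i :: alt n.+1 j i by [].
by rewrite IH /=; case: odd.
Qed.

Lemma alt_cat m n i j : (m <= n)%N ->
  exists t, alt n i j = alt m i j ++ t.
Proof.
elim: m n i j => [|m IH] [|n] i j //= mn; try by eexists.
by have [t ->] := IH n j i mn; exists t.
Qed.

Lemma cartan_off i j : i != j -> cartan D i j <= 0.
Proof. by move=> /(gcm_off D)[n]; rewrite /cartan => ->; rewrite oppr_le0 ler0n. Qed.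

Lemma sroot_srefl i j v :
  (sroot D j (srefl D i v) : R) = sroot D j v - (sroot D i v : R) * cartan D i j.
Proof. by rewrite /srefl linearB linearZ. Qed.

(** Pulling [x alpha_i + y alpha_j] back along [r_j] gives the coefficients [- a_ji x - y] of
    [alpha_j] and [x] of [alpha_i]. Since [a_ij a_ji >= 4], the inequality [2 x >= - a_ij y] passes
    to the new pair with [i] and [j] exchanged, and keeps it nonnegative. *)
Lemma alt_pos_infinite m i j (x y : R) v : i != j ->
  4 <= cartan D i j * cartan D j i ->
  0 <= x -> 0 <= y -> 2 * x >= - cartan D i j * y ->
  0 <= (sroot D i v : R) -> 0 <= (sroot D j v : R) ->
  0 <= x * (sroot D i (act (alt m j i) v) : R) + y * (sroot D j (act (alt m j i) v) : R).
Proof.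
elim: m i j x y => [|m IH] i j x y ij P x0 y0 xy vi vj /=.
  by rewrite addr_ge0 // mulr_ge0.
rewrite srefl_root sroot_srefl.
have := cartan_off ij; have := cartan_off; rewrite eq_sym in ij => /(_ _ _ ij).
set A := cartan D i j in P xy *; set B := cartan D j i in P xy * => B0 A0.
set p := (sroot D i _ : R); set q := (sroot D j _ : R).
have -> : x * (p - q * B) + y * - q = (- B * x - y) * q + x * p by ring.
apply: IH => //; first by rewrite mulrC.
- nra.
- by rewrite -/B; nra.
Qed.

(** Words in [i] and [j] only change two coroot coefficients, so a braid relation becomes a pair of
    scalar identities. *)
Lemma srefl_comb i j v (p q : R) :
  srefl D i (v - p *: scoroot D i - q *: scoroot D j) =
  v - ((sroot D i v : R) - p - q * cartan D j i) *: scoroot D i - q *: scoroot D j.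
Proof.
have E : (sroot D i (v - p *: scoroot D i - q *: scoroot D j) : R) =
    (sroot D i v : R) - p * 2 - q * cartan D j i.
  by rewrite !linearB !linearZ /= gcm_diag.
rewrite {1}/srefl E [LHS]addrAC; congr (_ + _).
rewrite -[LHS]addrA -opprD -scalerDl; congr (_ - _ *: _).
ring.
Qed.

(* [m] is the order of [r_i r_j]: 2, 3, 4 or 6 when the product of the two
   off-diagonal Cartan entries is 0, 1, 2 or 3. *)
Lemma braid i j : i != j -> cartan D i j * cartan D j i < 4 ->
  exists2 m, (0 < m)%N /\ act (alt m i j) =1 act (alt m j i) &
   forall n v, (n < m)%N -> 0 <= (sroot D i v : R) -> 0 <= (sroot D j v : R) ->
     0 <= (sroot D i (act (alt n j i) v) : R).
Proof.
move=> ij P.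
have [a Ea] := gcm_off D ij; have [b Eb] : exists n : nat, sroot D i (scoroot D j) = - n%:R.
  by apply: gcm_off; rewrite eq_sym.
have Z1 := @gcm_sym _ _ _ D i j; have Z2 := @gcm_sym _ _ _ D j i.
have cl v0 : v0 = v0 - (0:R) *: scoroot D i - (0:R) *: scoroot D j.
  by rewrite !scale0r !subr0.
have cr v0 (p q : R) : v0 - p *: scoroot D i - q *: scoroot D j =
    v0 - q *: scoroot D j - p *: scoroot D i by rewrite addrAC.
have eqc v0 (p q p' q' : R) : p = p' -> q = q' ->
  v0 - p *: scoroot D i - q *: scoroot D j = v0 - p' *: scoroot D i - q' *: scoroot D j.
  by move=> -> ->.
have ri v0 (p q : R) : srefl D i (v0 - p *: scoroot D i - q *: scoroot D j) =
  v0 - ((sroot D i v0 : R) - p + q * b%:R) *: scoroot D i - q *: scoroot D j.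
  by rewrite srefl_comb /cartan Eb mulrN opprK.
have rj v0 (p q : R) : srefl D j (v0 - p *: scoroot D i - q *: scoroot D j) =
  v0 - p *: scoroot D i - ((sroot D j v0 : R) - q + p * a%:R) *: scoroot D j.
  by rewrite cr srefl_comb /cartan Ea mulrN opprK cr.
have rti v0 : (sroot D i (srefl D j v0) : R) = sroot D i v0 + (sroot D j v0 : R) * b%:R.
  by rewrite sroot_srefl /cartan Eb mulrN opprK.
have rtj v0 : (sroot D j (srefl D i v0) : R) = sroot D j v0 + (sroot D i v0 : R) * a%:R.
  by rewrite sroot_srefl /cartan Ea mulrN opprK.
(* The natural numbers [a] and [b] vanish together and have product below 4. *)
have : ((a = 0 /\ b = 0) \/ (a = 1 /\ b = 1) \/ (a = 1 /\ b = 2) \/ (a = 2 /\ b = 1)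
  \/ (a = 1 /\ b = 3) \/ (a = 3 /\ b = 1))%N.
  move: P Z1 Z2; rewrite /cartan Ea Eb mulrNN -natrM.
  rewrite -[4]/(4%:R) ltr_nat => P Z1 Z2.
  have ab0 : a = 0%N -> b = 0%N.
    move=> a0; apply/eqP; rewrite -(pnatr_eq0 R) -oppr_eq0; apply/eqP/Z1.
    by rewrite a0 oppr0.
  have ba0 : b = 0%N -> a = 0%N.
    move=> a0; apply/eqP; rewrite -(pnatr_eq0 R) -oppr_eq0; apply/eqP/Z2.
    by rewrite a0 oppr0.
  by case: a P ab0 ba0 {Ea Eb Z1 Z2 ri rj rti rtj} => [|[|[|[|a]]]] P ab0 ba0;
    case: b P ab0 ba0 => [|[|[|[|b]]]] P ab0 ba0; move: (ab0) (ba0); lia.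
case=> [|[|[|[|[|]]]]] [? ?]; subst a b;
  [exists 2%N|exists 3%N|exists 4%N|exists 4%N|exists 6%N|exists 6%N].
all: try by split=> // v /=; rewrite (cl v) !(ri, rj); apply: eqc; ring.
all: move=> n v; do 6? [case: n => [|n] //=]; rewrite ?(srefl_root, rti, rtj); try lra.
Qed.

(** * Dominant vectors and Tits' theorem *)

Definition dominant v := forall i, 0 <= (sroot D i v : R).

(* Induction on [size s]: factor the longest alternating word in [j] (the last
   letter of [s]) and [i] out of [s] on the right; the remaining left factor is
   shortened by neither [i] nor [j]. *)
Lemma reduced_pos s i v : reduced s ->
  (forall t, act t =1 act (rcons s i) -> (size s <= size t)%N) ->
  dominant v -> 0 <= (sroot D i (act (rev s) v) : R).
Proof.
have [n sn] := ubnP (size s); elim: n s sn i => // n IH s sn i sred si vdom.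
case/lastP: s sn sred si => [|s j] sn sred si; first exact: vdom.
have ij : i != j.
  apply/eqP => ij; have : (size (rcons s j) <= size s)%N.
    by apply: si => u; rewrite ij !act_rcons sreflK.
  by rewrite size_rcons ltnn.
set w := rcons s j in sn sred si *.
pose Q m := `[< exists2 u, act (u ++ rev (alt m j i)) =1 act w & (size u + m)%N = size w >].
have Q1 : Q 1%N by apply/asboolP; exists s; rewrite ?size_rcons ?addn1 //= cats1.
have Qb m : Q m -> (m <= size w)%N by move=> /asboolP[u _ <-]; rewrite leq_addl.
case: (ex_maxnP (ex_intro Q _ Q1) Qb) => m /asboolP[u uw usz] mmax.
have m0 : (0 < m)%N by apply: mmax.
have ured : reduced u.
  move=> t tu; have : (size w <= size (t ++ rev (alt m j i)))%N.
    by apply: sred => x; rewrite act_cat tu -act_cat uw.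
  by rewrite size_cat size_rev size_alt -usz leq_add2r.
(* [p] is the last letter of [alt m j i] and [q] the letter that would continue it. If [q] shortened
   [u], [m] would not be maximal; if [p] did, [w] would not be reduced. *)
pose q := if odd m then i else j; pose p := if odd m then j else i.
have uq t : act t =1 act (rcons u q) -> (size u <= size t)%N.
  move=> tu; rewrite leqNgt; apply/negP => lt.
  have tw : act (t ++ rev (alt m.+1 j i)) =1 act w.
    by move=> x; rewrite alt_rcons rev_rcons act_cat tu act_rcons /= sreflK -act_cat uw.
  have := sred _ tw; rewrite size_cat size_rev size_alt => le.
  have /mmax : Q m.+1 by apply/asboolP; exists t => //; lia.
  by rewrite ltnn.
have up t : act t =1 act (rcons u p) -> (size u <= size t)%N.
  move=> tu; rewrite leqNgt; apply/negP => lt.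
  case: m m0 uw usz mmax {uq q} @p tu => // m _ uw usz _ p tu.
  have tw : act (t ++ rev (alt m j i)) =1 act w.
    move=> x; rewrite -uw alt_rcons rev_rcons !act_cat tu act_rcons /= /p /=.
    by case: (odd m).
  have := sred _ tw; rewrite size_cat size_rev size_alt; lia.
have un : (size u < n)%N by lia.
have pos k : k \in [:: i; j] -> 0 <= (sroot D k (act (rev u) v) : R).
  have Pp := IH _ un _ ured up vdom; have Pq := IH _ un _ ured uq vdom.
  by move: Pp Pq; rewrite /p /q !inE; case: odd => Pp Pq /orP[] /eqP ->.
have posi := pos i (mem_head _ _).
have posj : 0 <= (sroot D j (act (rev u) v) : R) by apply: pos; rewrite !inE eqxx orbT.
rewrite -(act_rev_eq uw) rev_cat revK act_cat.
have [fin|inf] := ltP (cartan D i j * cartan D j i) 4; last first.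
  have /= := @alt_pos_infinite m i j 1 0 _ ij inf ler01 (lexx _) _ posi posj.
  by rewrite mul1r mul0r addr0; apply; rewrite mulr0 mulr1.
have [M [M0 braidM] posM] := braid ij fin.
(* If [m] reached the order [M] of [r_i r_j], the braid relation would rewrite [w] to end in [i],
   and deleting that letter would contradict [si]. *)
apply: posM => //; rewrite ltnNge; apply/negP => Mm.
have [r rE] := alt_cat j i Mm.
case: M M0 braidM Mm rE => // M _ braidM Mm rE.
have := si (u ++ rev r ++ rev (alt M j i)); rewrite !size_cat !size_rev size_alt.
have szr : (M.+1 + size r)%N = m by rewrite -(size_alt m j i) rE size_cat size_alt.
have -> : (size w <= size u + (size r + M))%N = false by apply/negP; lia.
move=> absurd; apply: notF; apply: absurd => x; rewrite act_rcons -uw rE rev_cat !act_cat.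
by rewrite -(act_rev_eq braidM) /= rev_cons act_rcons sreflK.
Qed.

(** Let [j] be the last letter of a reduced word for [w]. Then [reduced_pos], applied to the
    dominant vector [w v], gives [alpha_j(v) <= 0], so [r_j] fixes [v] and the letter can be
    removed. *)
Lemma dominant_orbit w v : Wv D w -> dominant v -> dominant (w v) ->
  gen_group [set srefl D i | i in [set i | (sroot D i v : R) = 0]] w.
Proof.
move=> /WvE[s0 ->] vdom; have [s sred s0E] := reduced_word s0.
have -> : act s0 = act s by apply/funext => x; rewrite s0E.
move=> svdom {s0 s0E}; apply/gen_act.
have [n sn] := ubnP (size s); elim: n s sn sred svdom => // n IH s sn sred svdom.
case/lastP: s sn sred svdom => [|s j] sn sred svdom; first by exists [::].
have sred' : reduced s.
  move=> t ts; have := sred (rcons t j); rewrite !size_rcons; apply.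
  by move=> x; rewrite !act_rcons ts.
have sj t : act t =1 act (rcons s j) -> (size s <= size t)%N.
  by move=> /sred; rewrite size_rcons; apply: leq_trans.
have := reduced_pos sred' sj svdom; rewrite act_rcons act_revK srefl_root oppr_ge0 => vj.
have vj0 : (sroot D j v : R) = 0 by apply/eqP; rewrite eq_le vj vdom.
have jv : srefl D j v = v by rewrite /srefl vj0 scale0r subr0.
rewrite size_rcons ltnS in sn; rewrite act_rcons jv in svdom.
have [t tJ tE] := IH s sn sred' svdom.
exists (rcons t j) => [i|]; last first.
  by apply/funext => x; rewrite !act_rcons tE.
by rewrite mem_rcons inE => /orP[/eqP ->|/tJ].
Qed.

End WeylGroup.

(** * Theorems of the alternative for the Cartan matrix *)

Lemma free_codom_eq0 (K : fieldType) (U : vectType K) (I : finType) (a : I -> U)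
    (c : I -> K) :
  free (codom a) -> \sum_i c i *: a i = 0 -> forall i, c i = 0.
Proof.
move=> fr s0 i.
have /freeP/(_ (fun k : 'I_#|I| => c (enum_val k))) := (fr : free (codom_tuple a)).
have -> : \sum_(k < #|I|) c (enum_val k) *: (codom_tuple a)`_k = 0.
  rewrite -[RHS]s0 (reindex (@enum_val I I)) /=; last first.
    by exists enum_rank => k _; rewrite ?enum_valK ?enum_rankK.
  apply: eq_bigr => k _.
  congr (_ *: _); rewrite /= codomE (nth_map i) -?cardE //.
  by rewrite -(enum_val_nth i).
by move/(_ erefl (enum_rank i)); rewrite enum_rankK.
Qed.

(** The coordinate matrix of independent functionals is row free; a right inverse of it provides
    [v]. *)
Lemma free_functionals_surj (R : realType) (V : vectType R) (I : finType)
    (a : I -> 'Hom(V, R^o)) (c : I -> R) :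
  free (codom a) -> exists v, forall i, (a i v : R) = c i.
Proof.
move=> fr; pose e := vbasis {:V}; pose n := #|I|.
pose M := \matrix_(i < n, k < \dim {:V}) (a (enum_val i) e`_k : R).
have : row_free M.
  rewrite -kermx_eq0; apply/eqP/row_matrixP => r; rewrite row0.
  set u := row r _.
  have uM : u *m M = 0 by apply/sub_kermxP; rewrite row_sub.
  apply/rowP => k; rewrite [RHS]mxE -[k]enum_valK.
  pose c' i := u 0 (enum_rank i).
  apply: (free_codom_eq0 (c := c') fr).
  apply/lfunP => v; rewrite sum_lfunE lfunE /=.
  rewrite (coord_vbasis (memvf v)).
  under eq_bigr do rewrite lfunE /= linear_sum scaler_sumr.
  rewrite exchange_big big1 //= => l _.
  move/matrixP/(_ 0 l): uM; rewrite !mxE => uMl.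
  under eq_bigr do rewrite linearZ /= scalerA mulrC -scalerA.
  rewrite -scaler_sumr [X in _ *: X](_ : _ = 0) ?scaler0 // -[RHS]uMl.
  rewrite (reindex (@enum_rank I)) /=; last first.
    by exists enum_val => x _; rewrite ?enum_valK ?enum_rankK.
  by apply: eq_bigr => i _; rewrite /c' [M _ _]mxE enum_rankK.
case/row_freeP => B MB.
pose col := B *m (\col_k c (enum_val k)).
exists (\sum_l col l 0 *: e`_l) => i.
rewrite linear_sum /=.
have /matrixP/(_ (enum_rank i) 0) : M *m col = \col_k c (enum_val k).
  by rewrite /col mulmxA MB mul1mx.
rewrite mxE [RHS]mxE enum_rankK => <-; apply: eq_bigr => l _.
by rewrite linearZ /= [RHS]mulrC [M _ _]mxE enum_rankK.
Qed.

Lemma mx_subZE (K : pzRingType) (m n : nat) (A B : 'M[K]_(m, n)) c i j :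
  (A - c *: B) i j = A i j - c * B i j.
Proof. by rewrite !mxE. Qed.

Lemma pos_open (R : realType) (n : nat) (s : seq 'rV[R]_n) (x z : 'cV[R]_n) :
  (forall m, m \in s -> 0 < (m *m x) 0 0) ->
  exists2 e : R, 0 < e & forall m, m \in s -> 0 < (m *m (x + e *: z)) 0 0.
Proof.
elim: s => [|m s IHs] xs; first by exists 1.
have [|e e0 eP] := IHs; first by move=> m' ms; apply: xs; rewrite inE ms orbT.
have a0 : 0 < (m *m x) 0 0 by apply: xs; rewrite mem_head.
have mE (m' : 'rV[R]_n) d : (m' *m (x + d *: z)) 0 0 = (m' *m x) 0 0 + d * (m' *m z) 0 0.
  by rewrite mulmxDr -scalemxAr mxE [X in _ + X]mxE.
set a := (m *m x) 0 0 in a0; set b := (m *m z) 0 0.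
(* This bounds [d * |b|] by [a / 2], while [d <= e] preserves the inequalities of the tail. *)
pose d := Num.min e (a / (2 * (1 + `|b|))).
have b1 : 0 < 1 + `|b| by rewrite ltr_pwDl.
have d0 : 0 < d by rewrite lt_min e0 divr_gt0 // mulr_gt0.
exists d => // m'; rewrite inE mE => /orP[/eqP ->|ms].
  have dle : d * (1 + `|b|) <= a / 2.
    have : d <= a / (2 * (1 + `|b|)) by rewrite ge_min lexx orbT.
    by rewrite ler_pdivlMr ?mulr_gt0 //; lra.
  have := ler_norm (- b); rewrite normrN -/a -/b; nra.
have de : d <= e by rewrite ge_min lexx.
have := eP _ ms; have : 0 < (m' *m x) 0 0 by apply: xs; rewrite inE ms orbT.
rewrite mE; set p := (m' *m x) 0 0; set q := (m' *m z) 0 0 => p0.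
have [q0|q0] := leP 0 q; first by have := mulr_ge0 (ltW d0) q0; lra.
by have : e * q <= d * q by [rewrite ler_nM2r]; lra.
Qed.

(* Induction on the number of vectors: a solution [x] for the tail fails on the
   head [m] only if [x.m <= 0]; if [x.m < 0], replace the tail by its projections
   to the hyperplane orthogonal to [x] along [m]. *)
Lemma gordan (R : realType) (n : nat) (s : seq 'rV[R]_n) :
  (exists x : 'cV[R]_n, forall m, m \in s -> 0 < (m *m x) 0 0) \/
  (exists y : nat -> R, [/\ forall k, 0 <= y k, exists2 k, (k < size s)%N & 0 < y k &
     \sum_(k < size s) y k *: s`_k = 0]).
Proof.
have [N] := ubnP (size s); elim: N s => // N IH [|m s] /=.
  by move=> _; left; exists 0.
rewrite ltnS => sN; case: (IH s sN) => [[x xs]|[y [y0 [k ks yk] yE]]]; last first.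
  right; exists (fun k => if k is k'.+1 then y k' else 0); split.
  - by case.
  - by exists k.+1.
  - by rewrite big_ord_recl scale0r add0r; under eq_bigr do rewrite lift0.
have [xm|xm] := leP ((m *m x) 0 0) 0; last first.
  by left; exists x => m'; rewrite inE => /orP[/eqP ->|/xs].
have [xm0|xm0] := eqVneq ((m *m x) 0 0) 0.
  have [m0|m0] := eqVneq m 0.
    right; exists (fun k => if k is k'.+1 then 0 else 1); split.
    - by case.
    - by exists 0%N.
    - rewrite big_ord_recl /= m0 scaler0 add0r big1 // => k _.
      by rewrite /= scale0r.
  (* As [m] vanishes at [x], a small step along [m^T] makes it positive. *)
  have [e e0 eP] := pos_open (m^T) xs.
  left; exists (x + e *: m^T) => m'; rewrite inE => /orP[/eqP ->|/eP //].
  rewrite mulmxDr -scalemxAr mxE xm0 add0r mxE mulr_gt0 //.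
  rewrite mxE lt0r psumr_eq0; last by move=> k _; rewrite mxE -expr2 sqr_ge0.
  rewrite sumr_ge0 ?andbT; last by move=> k _; rewrite mxE -expr2 sqr_ge0.
  apply: contra_neqN m0 => /allP h; apply/rowP => k; rewrite mxE.
  by have := h k (mem_index_enum _); rewrite mxE mulf_eq0 orbb => /eqP.
have {}xm : (m *m x) 0 0 < 0 by rewrite lt_neqAle xm0.
set xm' := (m *m x) 0 0 in xm.
pose pr m' := m' - ((m' *m x) 0 0 / xm') *: m.
have prx m' : (pr m' *m x) 0 0 = 0.
  rewrite /pr mulmxBl -scalemxAl mx_subZE.
  by rewrite -/xm' divfK ?subrr // lt_eqF.
case: (IH (map pr s)); first by rewrite size_map.
- case=> x' x's; pose c := (m *m x') 0 0.
  (* [z] is killed by [m] and takes on the tail the values of [x'] on the projections. A small step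
     along [- x] will then make [m] positive. *)
  pose z := x' - (c / xm') *: x.
  have zm : (m *m z) 0 0 = 0.
    rewrite /z mulmxBr -scalemxAr mx_subZE.
    by rewrite -/xm' -/c divfK ?subrr // lt_eqF.
  have zs m' : m' \in s -> 0 < (m' *m z) 0 0.
    move=> ms; have := x's _ (map_f pr ms).
    have -> : pr m' *m x' = pr m' *m z.
      rewrite /z mulmxBr -scalemxAr [pr m' *m x](_ : _ = 0) ?scaler0 ?subr0 //.
      by apply/matrixP => i j; rewrite !ord1 prx mxE.
    rewrite /pr mulmxBl -scalemxAl.
    rewrite mx_subZE zm mulr0 subr0 //.
  have [e e0 eP] := pos_open (- x) zs;
  left; exists (z - e *: x) => m'; rewrite inE => /orP[/eqP ->|/eP]; rewrite ?scalerN //.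
  rewrite mulmxBr -scalemxAr mx_subZE zm.
  rewrite -/xm' sub0r -mulrN mulr_gt0 ?oppr_gt0 //.
case=> y [y0 [k ks yk] yE]; right.
rewrite size_map in ks yE.
(* The coefficient of [m] collects what the projections subtract; it is nonnegative because [x] is
   positive on the tail and negative on [m]. *)
exists (fun k => if k is k'.+1 then y k' else
  \sum_(k < size s) y k * ((s`_k *m x) 0 0 / (- xm'))); split.
- case=> // ; apply: sumr_ge0 => l _; rewrite mulr_ge0 // divr_ge0 ?oppr_ge0 ?(ltW xm) //.
  by rewrite ltW // xs // mem_nth.
- by exists k.+1.
rewrite big_ord_recl /= scaler_suml -big_split /= -[RHS]yE; apply: eq_bigr => l _.
rewrite (nth_map 0) // /pr scalerBr addrC; congr (_ + _).
by rewrite scalerA -scaleNr invrN mulrN mulrN.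
Qed.

(** * Components carrying a nonnegative null vector *)

Section AffineComponent.
Variables (R : realType) (V : vectType R) (I : finType) (D : vect_data V I).
Variable J : {set I}.
Hypothesis Jcomp : component D J.

Let e k l := cartan D k l != 0.

Lemma dynkin_sym : symmetric e.
Proof.
suff h k l : e k l -> e l k by move=> k l; apply/idP/idP => /h.
by rewrite /e; apply: contra_neq => /gcm_sym.
Qed.

(** A minimum principle: in the row of a zero of [Z] every term is nonpositive while the sum is not
    negative, so [Z] vanishes at all neighbours, hence on the connected component. *)
Lemma component_zero (Z : I -> R) i0 : i0 \in J -> Z i0 = 0 ->
  (forall j, j \in J -> 0 <= Z j) ->
  (forall i, i \in J -> Z i = 0 -> 0 <= \sum_(j in J) cartan D i j * Z j) ->
  forall j, j \in J -> Z j = 0.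
Proof.
move=> i0J Zi0 Z0 ZC; have [r Jr] := Jcomp.
have cs : connect_sym e := sym_connect_sym dynkin_sym.
have Je i : (i \in J) = connect e r i by rewrite Jr inE.
pose a := [pred i | (i \in J) && (Z i == 0)].
have ca : closed_mem e (mem a).
  apply: (intro_closed cs) => x y xy; rewrite !inE => /andP[xJ /eqP Zx].
  have yJ : y \in J by move: xJ; rewrite !Je => /connect_trans; apply; apply: connect1.
  rewrite yJ /=; have := ZC x xJ Zx.
  have neg j : j \in J -> cartan D x j * Z j <= 0.
    move=> jJ; have [<-|xj] := eqVneq x j; first by rewrite Zx mulr0.
    have [n nE] := gcm_off D xj.
    by rewrite /cartan nE mulNr oppr_le0 mulr_ge0 ?Z0 ?ler0n.
  rewrite (bigD1 y) //=; set S := \sum_(_ in _ | _) _ => h.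
  have : S <= 0 by apply: sumr_le0 => j /andP[jJ _]; apply: neg.
  move=> S0; have : cartan D x y * Z y = 0 by apply/eqP; rewrite eq_le neg //=; lra.
  by move/eqP; rewrite mulf_eq0 (negPf xy).
move=> j jJ; have : i0 \in a by rewrite inE i0J Zi0 eqxx.
rewrite (closed_connect ca (y := j)); first by rewrite inE => /andP[_ /eqP].
by rewrite -(same_connect cs (x := r)) -?Je.
Qed.

Lemma comp_mx_mulE (v : 'cV[R]_#|J|) (Z : I -> R) k :
  (forall l, v l 0 = Z (enum_val l)) ->
  (comp_mx D J *m v) k 0 = \sum_(j in J) cartan D (enum_val k) j * Z j.
Proof.
move=> vZ; rewrite mxE [RHS]big_enum_val; apply: eq_bigr => l _.
by rewrite mxE vZ.
Qed.

(** By [component_zero], [Y] is positive on all of [J]. The same principle shows that every [v] with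
    nonnegative image is proportional to [Y], which gives corank one and the last clause of affine
    type. *)
Lemma null_component_affine (Y : I -> R) j0 :
  j0 \in J -> (forall j, 0 <= Y j) -> 0 < Y j0 ->
  (forall i, \sum_j cartan D i j * Y j = 0) -> affine_type (comp_mx D J).
Proof.
move=> j0J Y0 Yj0 YC; have [r Jr] := Jcomp.
have YJ i : i \in J -> \sum_(j in J) cartan D i j * Y j = 0.
  move=> iJ; rewrite -[RHS](YC i) [RHS](bigID (mem J)) /= [X in _ + X]big1 ?addr0 //.
  move=> j jJ; suff -> : cartan D i j = 0 by rewrite mul0r.
  apply/eqP/negPn/negP => ij; move/negP: jJ; apply.
  by move: iJ; rewrite Jr !inE => /connect_trans; apply; apply: connect1.
have Ypos j : j \in J -> 0 < Y j.
  move=> jJ; rewrite lt_def Y0 andbT; apply/eqP => Yj.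
  have := @component_zero Y j jJ Yj (fun k _ => Y0 k).
  move=> /(_ _ j0 j0J) h; move: Yj0; rewrite h ?ltxx // => i iJ _.
  by rewrite YJ.
pose u : 'cV[R]_#|J| := \col_k Y (enum_val k).
have uY k : u k 0 = Y (enum_val k) by rewrite mxE.
have u0 k : 0 < u k 0 by rewrite uY Ypos ?enum_valP.
have Au : comp_mx D J *m u = 0.
  by apply/matrixP => k l; rewrite ord1 (comp_mx_mulE _ uY) YJ ?enum_valP // mxE.
pose k0 := enum_rank_in j0J j0.
(* With [c] the smallest ratio of [v] to [u], the vector [v - c *: u] is nonnegative and has a zero
   entry. *)
have multu v : (forall i, 0 <= (comp_mx D J *m v) i 0) -> exists c, v = c *: u.
  move=> Av; case: (Order.TotalTheory.arg_minP (fun k => v k 0 / u k 0) (erefl (xpredT k0))).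
  move=> k1 _ kmin; pose c := v k1 0 / u k1 0; exists c.
  pose Z j := (v - c *: u) (enum_rank_in j0J j) 0.
  have zZ l : (v - c *: u) l 0 = Z (enum_val l) by rewrite /Z enum_valK_in.
  apply/eqP; rewrite -subr_eq0; apply/eqP/matrixP => k l; rewrite ord1 zZ [RHS]mxE.
  apply: (@component_zero Z (enum_val k1)); rewrite ?enum_valP //.
  - by rewrite -zZ mx_subZE /c divfK ?subrr // gt_eqF.
  - move=> j jJ; rewrite /Z mx_subZE subr_ge0 -ler_pdivlMr //; exact: kmin.
  - move=> i iJ _; rewrite -(enum_rankK_in j0J iJ) -(comp_mx_mulE _ zZ).
    by rewrite mulmxBr -scalemxAr Au scaler0 subr0.
split.
- have kr : (kermx (comp_mx D J)^T :=: u^T)%MS.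
    apply/eqmxP/andP; split; last first.
      by apply/sub_kermxP; rewrite -trmx_mul Au trmx0.
    apply/row_subP => k; set w := row k _.
    have : w *m (comp_mx D J)^T = 0 by apply/sub_kermxP; rewrite row_sub.
    move=> /(congr1 trmx); rewrite trmx_mul trmxK trmx0 => Aw.
    have [|c wc] := multu w^T; first by move=> i; rewrite Aw mxE.
    by rewrite -[w]trmxK wc linearZ /= scalemx_sub.
  have := mxrank_ker (comp_mx D J)^T; rewrite kr !mxrank_tr.
  have -> : \rank u = 1%N.
    apply/eqP; rewrite eqn_leq rank_leq_col lt0n mxrank_eq0.
    by apply/eqP => /matrixP/(_ k0 0); rewrite [RHS]mxE => h; move: (u0 k0); rewrite h ltxx.
  have := rank_leq_row (comp_mx D J); lia.
- by exists u.
- by move=> v /multu[c ->]; rewrite -scalemxAr Au scaler0.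
Qed.

End AffineComponent.

(** The sum is the value of [alpha_j] at the combination of coroots with coefficients [x]. Gordan's
    alternative is applied to the columns of the Cartan matrix. *)
Lemma no_affine_factor_pos (R : realType) (V : vectType R) (I : finType)
    (D : vect_data V I) : no_affine_factor D ->
  exists x : I -> R, forall j, 0 < \sum_i x i * cartan D i j.
Proof.
move=> na; pose m j := \row_k cartan D (@enum_val I I k) j.
have rk (F : I -> R) : \sum_i F i = \sum_(k < #|I|) F (enum_val k).
  rewrite (reindex (@enum_val I I)) //=.
  by exists enum_rank => x _; rewrite ?enum_valK ?enum_rankK.
case: (gordan (map m (enum I))) => [[x xP]|[y [y0 [k ks yk] yE]]].
  exists (fun i => x (enum_rank i) 0) => j.
  have := xP _ (map_f m (mem_enum I j)); rewrite rk mxE; set S := \sum_j _.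
  congr (_ < _); apply: eq_bigr => k _; rewrite mxE enum_valK mulrC //.
rewrite size_map -cardE in ks yE; pose Y (j : I) := y (enum_rank j).
pose j0 := enum_val (Ordinal ks).
have Yj0 : 0 < Y j0 by rewrite /Y /j0 enum_valK.
pose J := [set j | connect (fun k l => cartan D k l != 0) j0 j]%SET.
have Jc : component D J by exists j0.
exfalso; apply: (na J Jc); apply: (@null_component_affine _ _ _ D J Jc Y j0).
- by rewrite inE connect0.
- by move=> j; apply: y0.
- by [].
move=> i; rewrite rk; move/matrixP/(_ 0 (enum_rank i)): yE.
rewrite [RHS]mxE summxE => yE; rewrite -[RHS]yE; apply: eq_bigr => l _.
rewrite mxE (nth_map i) -?cardE // mxE enum_rankK /Y enum_valK mulrC.
by rewrite -enum_val_nth.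
Qed.

(** * Vectorial faces as simplicial cones *)

Section Cones.
Variables (R : realType) (V : vectType R) (I : finType) (D : vect_data V I).
Implicit Types (b : I -> 'Hom(V, R^o)) (J : {set I}) (F : set V).

(** Models the images of the simple roots under an element of [Wv], up to a common sign, so that
    faces of both signs are treated alike. The second clause encodes linear independence. *)
Definition frame b :=
  (forall j, real_root D (b j)) /\
  (forall c : I -> R, exists v, forall j, (b j v : R) = c j).

Definition cone b J : set V :=
  [set v | forall i, if i \in J then (b i v : R) = 0 else 0 < (b i v : R)].

(** Elements of [Wv] are bare functions; this turns composition with one of them into a linear
    form. *)
Lemma pull_root s (a : 'Hom(V, R^o)) :
  exists a' : 'Hom(V, R^o), forall v, a' v = a (act D s v).
Proof.
elim: s a => [|i s IH] a; first by exists a.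
have [a' a'E] := IH (a - (a (scoroot D i) : R) *: sroot D i).
exists a' => v; rewrite a'E /= /srefl; move: (act D s v) => z.
rewrite add_lfunE opp_lfunE scale_lfunE linearB; congr (_ - _).
by rewrite linearZ /= /GRing.scale /= mulrC.
Qed.

Lemma frame_sroot : frame (sroot D).
Proof.
split=> [j|c]; last exact: free_functionals_surj (sroot_free D).
by exists (scoroot D j), id, j; split=> //; apply: gen_id.
Qed.

Lemma Wv_inv w : Wv D w -> exists2 w', Wv D w' & cancel w w' /\ cancel w' w.
Proof.
move=> /WvE[s ->]; exists (act D (rev s)); first by apply/WvE; exists (rev s).
by split; [exact: act_revK|exact: act_Krev].
Qed.

Lemma Wv_lin w : Wv D w -> forall c u v, w (c *: u + v) = c *: w u + w v.
Proof. by move=> /WvE[s ->] c u v; rewrite act_lin. Qed.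

Lemma Wv_zero w : Wv D w -> w 0 = 0.
Proof.
move=> /Wv_lin wl; have := wl (-1) 0 0.
by rewrite scaler0 addr0 scaleN1r addNr.
Qed.

Lemma Wv_scale w c v : Wv D w -> w (c *: v) = c *: w v.
Proof. by move=> ww; rewrite -[c *: v]addr0 Wv_lin // Wv_zero // addr0. Qed.

Lemma Wv_add w u v : Wv D w -> w (u + v) = w u + w v.
Proof. by move=> ww; rewrite -[u]scale1r Wv_lin // !scale1r. Qed.

Lemma Wv_opp w v : Wv D w -> w (- v) = - w v.
Proof. by move=> ww; rewrite -scaleN1r Wv_scale // scaleN1r. Qed.

Lemma Wv_comp w w' : Wv D w -> Wv D w' -> Wv D (w \o w').
Proof. exact: gen_comp. Qed.

Lemma real_rootN a : real_root D a -> real_root D (- a).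
Proof.
move=> [av [w [i [ww aw avE]]]]; exists (w (srefl D i (scoroot D i))).
exists (w \o srefl D i), i; split=> //.
  by apply: Wv_comp => //; apply: gen_in; exists i.
by move=> v; rewrite /= lfunE /= aw srefl_root opprK.
Qed.

Lemma vface_cone s J F : vface D s J F -> exists2 b, frame b & F = cone b J.
Proof.
move=> [w ww ->]; have [w' /WvE[t w'E] [wK Kw]] := Wv_inv ww.
pose sg (v : V) := if s then v else - v.
have /choice[b bE] : forall j, exists a : 'Hom(V, R^o),
    forall v, (a v : R) = sroot D j (w' (sg v)).
  move=> j; have [a aE] := pull_root t (if s then sroot D j else - sroot D j).
  exists a => v; rewrite aE w'E /sg; case: (s) => //.
  by rewrite -w'E opp_lfunE Wv_opp ?linearN //; apply/WvE; exists t; rewrite w'E.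
have sgw v : sg (w v) = w (sg v) by rewrite /sg; case: (s) => //; rewrite Wv_opp.
have sgsg v : sg (sg v) = v by rewrite /sg; case: (s); rewrite ?opprK.
have bw v j : (b j (sg (w v)) : R) = sroot D j v by rewrite bE sgsg wK.
exists b; [split|].
- move=> j; suff : real_root D (if s then b j else - b j).
    by case: (s) => // /real_rootN; rewrite opprK.
  exists (w (scoroot D j)), w, j; split=> // v.
  rewrite -bw /sg; case: (s) => //.
  by rewrite lfunE /= linearN.
- move=> c; have [v vc] := frame_sroot.2 c; exists (sg (w v)) => j.
  by rewrite bw.
apply/seteqP; split=> [_ [v vF <-] i|v vF].
  by have := vF i; rewrite -bw.
exists (w' (sg v)); last by rewrite -/(sg _) Kw.
by move=> i; have := vF i; rewrite bE.
Qed.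

Lemma cone_neq0 b J : frame b -> exists v, cone b J v.
Proof.
move=> [_ bs]; have [v vE] := bs (fun i => if i \in J then 0 else 1).
by exists v => i; rewrite vE; case: (i \in J).
Qed.

Lemma coneD b J u v : cone b J u -> cone b J v -> cone b J (u + v).
Proof.
move=> uF vF i; have := uF i; have := vF i; rewrite linearD /=.
by case: (i \in J) => [-> ->|v0 u0]; rewrite ?addr0 ?addr_gt0.
Qed.

Lemma coneZ b J (c : R) v : 0 < c -> cone b J v -> cone b J (c *: v).
Proof.
move=> c0 vF i; have := vF i; rewrite linearZ /=.
by case: (i \in J) => [->|v0]; rewrite ?scaler0 ?mulr_gt0.
Qed.

(** Outside [J] each [b i u] is positive, and [t0] exceeds all the ratios of [b i v] to it. Thus a
    direction of the face absorbs any vector of its linear span. *)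
Lemma cone_absorb b J v u : (forall j, j \in J -> (b j v : R) = 0) -> cone b J u ->
  exists2 t0 : R, 0 < t0 & forall t, t0 <= t -> cone b J (v + t *: u).
Proof.
move=> vJ uF; pose t0 := 1 + \sum_i `|(b i v : R) / b i u|.
have t00 : 0 < t0 by rewrite ltr_pwDl // sumr_ge0.
exists t0 => // t tt i; have := uF i; rewrite linearD linearZ /=.
have [iJ ->|iJ ui] := boolP (i \in J); first by rewrite scaler0 addr0 vJ.
have : `|(b i v : R) / b i u| < t.
  apply: lt_le_trans tt; rewrite /t0 (bigD1 i) //= addrCA ltrDl ltr_pwDl // sumr_ge0 //.
rewrite normrM normfV (gtr0_norm ui) ltr_pdivrMr // => h.
have := ler_norm (- (b i v : R)); rewrite normrN /GRing.scale /=; lra.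
Qed.

Lemma vnbhs_small (v x : V) U : vnbhs x U -> exists2 e : R, 0 < e & U (x + e *: v).
Proof.
move=> [d d0 dU]; pose m := 1 + \sum_i `|coord (vbasis {:V}) i v|.
have m0 : 0 < m by rewrite ltr_pwDl // sumr_ge0.
exists (d / m); first by rewrite divr_gt0.
apply: dU => i; rewrite addrC addKr linearZ /= normrM gtr0_norm ?divr_gt0 //.
rewrite mulrAC ltr_pdivrMr // ltr_pM2l //.
by rewrite /m (bigD1 i) //= addrCA ltrDl ltr_pwDl // sumr_ge0.
Qed.

End Cones.

(** * Walls, enclosures and chimneys *)

Section Walls.
Variables (R : realType) (V : vectType R) (I : finType) (D : vect_data V I).
Variable X : model_apartment D.
Implicit Types (b : I -> 'Hom(V, R^o)) (J : {set I}) (F : set V).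

Lemma root_pair_coroot a av : root_pair D a av -> (a av : R) = 2.
Proof. by move=> [w [i [_ aw ->]]]; rewrite aw gcm_diag. Qed.

(** The reflection in the wall of level [k] permutes the walls parallel to it, so [Lam] is symmetric
    about each of its points. *)
Lemma Lam_refl a k l : real_root D a -> Lam X a k -> Lam X a l ->
  Lam X a (2 * k - l).
Proof.
move=> [av rp] ak al; have a2 := root_pair_coroot rp.
have -> : (Lam X a (2 * k - l) : Prop) = walls X (hrefl a av k @` hyp a l).
  rewrite /Lam /=; congr (walls X _); apply/seteqP.
  have aE (v : V) : (a (hrefl a av k v) : R) = - (a v : R) - 2 * k.
    by rewrite /hrefl linearB linearZ /= a2 /GRing.scale /=; ring.
  split=> [v /= vh|_ [v /= vh <-]]; last by move: vh; rewrite /hyp /= aE; lra.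
  exists (hrefl a av k v); first by move: vh; rewrite /hyp /= aE; lra.
  rewrite {1}/hrefl aE /hrefl -addrA -opprD -scalerDl.
  by rewrite [X in X *: _](_ : _ = 0) ?scale0r ?subr0 //; ring.
apply: walls_stable => //; apply: gen_in; exists a, av, k; split=> //.
Qed.

Lemma Lam0 a : real_root D a -> Lam X a 0.
Proof. exact: walls0. Qed.

Lemma LamN_root a k : Lam X a k -> Lam X (- a) (- k).
Proof.
rewrite /Lam /=; congr (walls X _); apply/seteqP; split=> v; rewrite /hyp /= opp_lfunE; lra.
Qed.

Lemma LamN a k : real_root D a -> Lam X a k -> Lam X a (- k).
Proof. by move=> ra ak; rewrite -[- k]add0r -(mulr0 2); apply: Lam_refl => //; apply: Lam0. Qed.

Lemma Lam_trans a k l (n : nat) : real_root D a -> Lam X a k -> Lam X a l ->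
  Lam X a (l + (2 * k) *+ n).
Proof.
move=> ra ak al; elim: n => [|n IH]; first by rewrite mulr0n addr0.
have := Lam_refl ra ak (LamN ra IH); congr (Lam X a _).
by rewrite mulrSr; ring.
Qed.

(** Infinitude gives a nonzero level, and the shifts by twice that level are unbounded. This
    supplies walls beyond any bound when enclosures are built. *)
Lemma Lam_large a M : real_root D a -> exists2 k, Lam X a k & M < k.
Proof.
move=> ra.
have [k ak k0] : exists2 k, Lam X a k & 0 < k.
  apply: contrapT => h; apply: (walls_infinite (m := X) ra).
  apply: (@sub_finite_set _ _ [set 0]); last exact: finite_set1.
  move=> k ak /=; apply/eqP; apply: contrapT => /negP k0; apply: h.
  have [k1|k1] := ltP 0 k; first by exists k.
  by exists (- k); [apply: LamN|rewrite oppr_gt0 lt_neqAle k0].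
have [n nM] : exists n : nat, `|M| / k < n%:R.
  by exists (Num.Def.archi_bound (`|M| / k)); apply: archi_boundP; rewrite divr_ge0 // ltW.
exists (0 + (2 * k) *+ n); first by apply: Lam_trans => //; apply: Lam0.
move: nM; rewrite ltr_pdivrMr // => nM; rewrite add0r -mulr_natl.
have := ler_norm M; have : 0 <= n%:R * k by rewrite mulr_ge0 // ltW. lra.
Qed.

(** Only the frame roots, and their opposites for indices in [J], get a finite level. All others, in
    particular any imaginary root outside this list, get [+oo]. *)
Lemma enclosed_frame b J (kap : I -> R) : frame D b -> (forall j, Lam X (b j) (kap j)) ->
  exists2 k, admissible X k & enclosed_set D k =
    [set v | forall j, 0 <= (b j v : R) + kap j /\ (j \in J -> (b j v : R) + kap j <= 0)].
Proof.
move=> bfr bk.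
have [v1 v1E] := bfr.2 (fun=> 1).
have binj j l : b j = b l -> j = l.
  move=> jl; have [v vE] := bfr.2 (fun i => (i == j)%:R).
  have := vE l; rewrite -jl vE eqxx; case: eqP => // _ /eqP.
  by rewrite oner_eq0.
have bneg j l : - b j <> b l.
  by move=> /(congr1 (fun a : 'Hom(V, R^o) => (a v1 : R))); rewrite opp_lfunE /= !v1E; lra.
pose k (a : 'Hom(V, R^o)) : \bar R :=
  if [pick j | a == b j] is Some j then (kap j)%:E else
  if [pick j | (j \in J) && (a == - b j)] is Some j then (- kap j)%:E else +oo%E.
have kb j : k (b j) = (kap j)%:E.
  by rewrite /k; case: pickP => [l /eqP/binj ->|/(_ j)] //; rewrite eqxx.
have kn j : j \in J -> k (- b j) = (- kap j)%:E.
  move=> jJ; rewrite /k; case: pickP => [l /eqP/bneg //|_].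
  case: pickP => [l /andP[_ /eqP/oppr_inj/binj ->]|/(_ j)] //.
  by rewrite eqxx jJ.
have kc a : [\/ exists j, a = b j, exists2 j, j \in J & a = - b j | k a = +oo%E].
  rewrite /k; case: pickP => [l /eqP ->|_]; first by constructor 1; exists l.
  by case: pickP => [l /andP[lJ /eqP ->]|_]; [constructor 2; exists l|constructor 3].
exists k.
  move=> a; split=> ra; case: (kc a) => [[j aE]|[j jJ aE]|->]; try (by left); right.
  - by exists (kap j); rewrite aE.
  - by exists (- kap j); rewrite aE ?kn //; apply: LamN_root.
  - by exists (kap j); rewrite aE.
  - by exists (- kap j); rewrite aE ?kn.
apply/seteqP; split=> v vk => [j|a ra].
  split=> [|jJ].
    by have := vk (b j) (or_introl (bfr.1 j)); rewrite kb -EFinD lee_fin.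
  have := vk (- b j) (or_introl (real_rootN (bfr.1 j))).
  by rewrite kn // -EFinD lee_fin opp_lfunE -opprD oppr_ge0.
case: (kc a) => [[j ->]|[j jJ ->]|->]; last by rewrite addey.
- by rewrite kb -EFinD lee_fin (vk j).1.
- by rewrite kn // -EFinD lee_fin opp_lfunE -opprD oppr_ge0 (vk j).2.
Qed.

(* The base points [x] for which [x + cone b J] lies in an intersection of walls
   having the same direction as [cone b J]. *)
Definition on_walls b J (x : V) := forall j, j \in J -> Lam X (b j) (- (b j x : R)).

(** Far enough inside the face, the enclosure is cut out by walls of frame roots and stays in
    [x + cone b J]; for indices in [J] the walls pass through [x]. *)
Lemma chimney_germ_sub b J x (S : set V) : frame D b -> on_walls b J x ->
  trans x (cone b J) `<=` S -> chimney_germ X (local_face x (cone b J)) (cone b J) S.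
Proof.
move=> bfr gx xS.
have /choice[kap kapP] : forall j, exists kap, Lam X (b j) kap /\
    if j \in J then kap = - (b j x : R) else kap < - (b j x : R).
  move=> j; case: (boolP (j \in J)) => [jJ|_]; first by exists (- (b j x : R)); split=> //; apply: gx.
  have [k ka kb] := Lam_large (b j x) (bfr.1 j); exists (- k); split; first exact: LamN (bfr.1 j) _.
  by rewrite ltrN2.
(* [xi] moves the apex onto the chosen walls, which lie strictly inside the cone. *)
have [xi xiE] := bfr.2 (fun j => if j \in J then 0 else - kap j - (b j x : R)).
have [k ka kE] := enclosed_frame J bfr (fun j => (kapP j).1).
exists xi.
  by move=> i; rewrite xiE; case: (boolP (i \in J)) (kapP i).2 => // _; lra.
exists k; split=> //.
  exists (trans xi (trans x (cone b J))).
    exists (trans x (cone b J)) => //; exists setT; first by exists 1.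
    by rewrite setTI.
  rewrite kE => _ [_ [_ [v vF <-] <-] [v' v'F <-]] j.
  rewrite !linearD /= xiE; have := (kapP j).2; have := vF j; have := v'F j.
  by case: ifP => [jJ -> -> ->|jJ]; [split=> [|_]; lra|split=> //; lra].
apply: subset_trans xS; rewrite kE => v vE.
exists (v - x); last by rewrite addrC subrK.
move=> j; rewrite linearB /=; have [v0 v1] := vE j; have := (kapP j).2.
by case: ifP v1 => [_ /(_ isT)|_ _]; [move=> ? ?; lra|lra].
Qed.

(** A member contains the whole cone issued from each point of a shifted local face; such a point is
    found by a small step along [u]. *)
Lemma chimney_germ_mem b J x (S : set V) : frame D b ->
  chimney_germ X (local_face x (cone b J)) (cone b J) S ->
  exists2 y, trans x (cone b J) y & trans y (cone b J) `<=` S.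
Proof.
move=> bfr [xi xiF [k [_ [T [T0 [U xU UT0] T0T] Tk] kS]]].
have [u uF] := cone_neq0 J bfr; have [e e0 eU] := vnbhs_small u xU.
exists (xi + (x + e *: u)).
  exists (xi + e *: u); last by rewrite addrCA.
  by apply: coneD => //; apply: coneZ.
move=> _ [v vF <-]; apply: kS; apply: Tk; exists (xi + (x + e *: u)); last by exists v.
apply: T0T; exists (x + e *: u) => //; apply: UT0; split=> //.
by exists (e *: u) => //; apply: coneZ.
Qed.

(** A root of finite level is bounded below on two opposite cones, so it vanishes on the open cone,
    which spans [V]; its half-space is then everything. *)
Lemma enclosed_opposite_sectors b k y z : frame D b ->
  trans y (cone b finset.set0) `<=` enclosed_set D k ->
  trans z [set - v | v in cone b finset.set0] `<=` enclosed_set D k ->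
  enclosed_set D k = setT.
Proof.
move=> bfr yk zk; apply/seteqP; split=> // v _ a ra.
have bsp (c : I -> R) : exists v, forall i, (b i v : R) = c i by apply: bfr.2.
have [u uF] := cone_neq0 finset.set0 bfr.
have ay w : cone b finset.set0 w -> (0 <= (a (y + w) : R)%:E + k a)%E.
  by move=> wF; apply: yk => //; exists w.
have az w : cone b finset.set0 w -> (0 <= (a (z - w) : R)%:E + k a)%E.
  by move=> wF; apply: zk => //; exists (- w) => //; exists w.
case kaE : (k a) (ay) (az) => [r| |] ay' az'; [|by rewrite addey|]; last first.
  by have := ay' u uF; rewrite addeNy.
have a0 w : cone b finset.set0 w -> (a w : R) = 0.
  move=> wF; apply: contrapT => /eqP aw0.
  pose t := 1 + (`|a y + r : R| + `|a z + r : R|) / `|a w : R|.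
  have aw1 : 0 < `|a w : R| by rewrite normr_gt0.
  have t0 : 0 < t by rewrite ltr_pwDl // divr_ge0 ?addr_ge0 // ltW.
  have twF : cone b finset.set0 (t *: w) by apply: coneZ.
  have := ay' _ twF; have := az' _ twF; rewrite -!EFinD !lee_fin linearB linearD linearZ /=.
  have tw : t * `|a w : R| = `|a w : R| + (`|a y + r : R| + `|a z + r : R|).
    by rewrite mulrDl mul1r divfK // gt_eqF.
  have := ler_norm (a y + r : R); have := ler_norm (a z + r : R).
  have := normr_ge0 (a y + r : R); have := normr_ge0 (a z + r : R).
  rewrite /GRing.scale /=; case: (ltP 0 (a w : R)) => [aw|aw]; move: tw aw1.
    by rewrite gtr0_norm // => tw aw1; lra.
  by rewrite ler0_norm // => tw aw1; lra.
have -> : (a v : R) = a (y + u).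
  have [t0 t00 /(_ _ (lexx _)) tF] := @cone_absorb _ _ _ b finset.set0 (v - y) u
     (fun j jJ => ltac:(by rewrite inE in jJ)) uF.
  have := a0 _ tF; have := a0 u uF; rewrite !linearD linearZ /= => au0.
  by rewrite au0 scaler0 !addr0 linearN /= => /eqP; rewrite subr_eq0 => /eqP.
by apply: ay'.
Qed.

Lemma wall_space b J : exists U : {vspace V},
  forall v, (v \in U) = [forall j in J, (b j v : R) == 0].
Proof.
exists (\bigcap_(j in J) lker (b j))%VS => v.
rewrite memvE; apply/subv_bigcapP/forall_inP => h j jJ.
  by have := h j jJ; rewrite -memvE memv_ker.
by rewrite -memvE memv_ker h.
Qed.

(** By [dominant_orbit], the stabilizer of an interior point is conjugate to the subgroup generated
    by the reflections of [J]. *)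
Lemma finite_stabilizer s J F : spherical D J -> vface D s J F ->
  exists2 u, F u & finite_set [set w | Wv D w /\ w u = u].
Proof.
move=> sJ [w0 ww0 ->]; have [w1 ww1 [w0K w1K]] := Wv_inv ww0.
have [u0 u0F] := cone_neq0 J (frame_sroot D).
have u0dom : dominant D u0.
  by move=> i; have := u0F i; case: ifP => [_ ->|_ /ltW].
have u0J : [set i | (sroot D i u0 : R) = 0] = [set` J].
  apply/seteqP; split=> i /=; have := u0F i; case: ifP => // _.
  by move=> h h'; move: h; rewrite h' ltxx.
pose sg (v : V) := if s then v else - v.
exists (sg (w0 u0)); first by exists u0.
apply: (@sub_finite_set _ _ [set w0 \o g \o w1 |
    g in gen_group [set srefl D i | i in [set` J]]]); last exact: finite_image.
move=> w [ww wu]; have {}wu : w (w0 u0) = w0 u0.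
  by move: wu; rewrite /sg; case: s {sg} => //; rewrite (Wv_opp _ ww) => /oppr_inj.
exists (w1 \o w \o w0); last by apply/funext => v; rewrite /= !w1K.
rewrite -u0J; apply: dominant_orbit => //; last by rewrite /= wu w0K.
by apply: Wv_comp => //; apply: Wv_comp.
Qed.

(** The support is [x] plus the common kernel of the [b j], [j] in [J]: the walls through [x]
    confine the enclosure to it and the cone spans it. Its pointwise stabilizer fixes an interior
    point of a spherical face. *)
Lemma solid_face s b J x : frame D b -> on_walls b J x -> spherical D J ->
  vface D s J (cone b J) -> solid D (chimney X (local_face x (cone b J)) (cone b J)).
Proof.
move=> bfr gx sJ bF; have [U UE] := wall_space b J.
have UP v : reflect (forall j, j \in J -> (b j v : R) = 0) (v \in U).
  rewrite UE; apply: (iffP forall_inP) => h j jJ; first exact/eqP/h.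
  by rewrite h.
have FU u : cone b J u -> u \in U.
  by move=> uF; apply/UP => j jJ; have := uF j; rewrite jJ.
have [u uF] := cone_neq0 J bfr.
exists x, U; split; first split.
- have /choice[kap kapP] : forall j, exists kap, Lam X (b j) kap /\
      if j \in J then kap = - (b j x : R) else - (b j x : R) <= kap.
    move=> j; case: (boolP (j \in J)) => [jJ|_].
      by exists (- (b j x : R)); split=> //; apply: gx.
    by have [k ka /ltW kb] := Lam_large (- (b j x : R)) (bfr.1 j); exists k.
  have [k ka kE] := enclosed_frame J bfr (fun j => (kapP j).1).
  exists k; split=> //; rewrite kE.
    exists (trans x (cone b J)).
      by exists setT; [exists 1|rewrite setTI].
    move=> _ [_ [v vF <-] [v' v'F <-]] j; rewrite !linearD /=.
    have := (kapP j).2; have := vF j; have := v'F j.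
    by case: ifP => [jJ -> -> ->|jJ]; [split=> [|_]; lra|split=> //; lra].
  move=> v vE; exists (v - x); last by rewrite addrC subrK.
  apply/UP => j jJ; rewrite linearB /=; have [v0 /(_ jJ) v1] := vE j.
  by have := (kapP j).2; rewrite jJ; lra.
- move=> y U' [k [_ [T [U0 xU0 U0T] Tk] kU']].
  have [e e0 eU0] := vnbhs_small u xU0.
  have yU v : cone b J v -> x + e *: u + v - y \in U'.
    move=> wF; have [] : faff y U' (x + e *: u + v).
      apply: kU'; apply: Tk; exists (x + e *: u); last by exists v.
      by apply: U0T; split=> //; exists (e *: u) => //; apply: coneZ.
    by move=> v' v'U <-; rewrite addrAC subrr add0r.
  have FU' v : cone b J v -> v \in U'.
    move=> wF; have w2F := coneD wF wF.
    by have := memvB (yU _ w2F) (yU _ wF); rewrite opprB addrA subrK addrA addrAC subrr add0r.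
  have UU' v : v \in U -> v \in U'.
    move=> /UP vU; have [t t0 /(_ _ (lexx _)) tF] := cone_absorb vU uF.
    by have := memvB (FU' _ tF) (memvZ t (FU' _ uF)); rewrite addrK.
  move=> _ [v vU <-]; exists (x + v - y); last by rewrite addrC subrK.
  have -> : x + v - y = (x + e *: u + u - y) + (v - (e *: u + u)).
    rewrite -[x + e *: u + u]addrA; move: (e *: u + u) => p.
    by rewrite [x + p - y]addrAC [v - p]addrC [RHS]addrA addrK addrAC.
  apply: rpredD; first exact: yU.
  by apply: UU'; rewrite memvB // memvD // ?memvZ // FU.
have [u1 u1F fin] := finite_stabilizer sJ bF.
apply: sub_finite_set fin => w [ww wU]; split=> //.
by apply: wU; apply: FU.
Qed.

End Walls.

(** * Comparison of two apartments along sector-faces *)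

Section Transfer.
Variables (R : realType) (V : vectType R) (I : finType) (D : vect_data V I).
Variables (X : model_apartment D) (Delta : Type) (H : apt_system X Delta).
Hypothesis hovel : ordered_affine_hovel H.
Implicit Types (A : set Delta) (f : V -> Delta) (b : I -> 'Hom(V, R^o)) (J : {set I}).

Lemma Wa_affine w : Wa X w -> exists w0 t, Wv D w0 /\ forall v, w v = w0 v + t.
Proof.
elim=> [|g [a [av [k [[w0 [i [ww0 aw avE]]] _ ->]]]]|g h _ [w1 [t1 [ww1 E1]]] _ [w2 [t2 [ww2 E2]]]
       |g h _ [w1 [t1 [ww1 E1]]] gh hg].
- by exists id, 0; split; [exact: gen_id|move=> v; rewrite addr0].
- have [w1 ww1 [w0K w1K]] := Wv_inv ww0.
  exists (w0 \o srefl D i \o w1), (- k *: av); split.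
    apply: Wv_comp => //; apply: Wv_comp => //; apply: gen_in; exists i => //.
  move=> v; rewrite /hrefl scalerDl opprD addrA scaleNr; congr (_ - _).
  by rewrite /= /srefl (Wv_add _ _ ww0) (Wv_opp _ ww0) (Wv_scale _ _ ww0) w1K -avE -aw w1K.
- exists (w1 \o w2), (w1 t2 + t1); split; first exact: Wv_comp.
  by move=> v; rewrite /= E2 E1 (Wv_add _ _ ww1) addrA.
- have [w2 ww2 [w1K w2K]] := Wv_inv ww1.
  exists w2, (- w2 t1); split=> // v.
  by rewrite -{2}(hg v) E1 (Wv_add _ _ ww2) w1K addrK.
Qed.

Lemma Wa_inv w : Wa X w -> exists2 w', Wa X w' & cancel w w' /\ cancel w' w.
Proof.
move=> ww; have [w0 [t [ww0 wE]]] := Wa_affine ww.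
have [w1 ww1 [w0K w1K]] := Wv_inv ww0.
have K : cancel w (fun v => w1 (v - t)) by move=> v; rewrite wE addrK.
have K' : cancel (fun v => w1 (v - t)) w by move=> v; rewrite wE w1K subrK.
by exists (fun v => w1 (v - t)) => //; apply: gen_inv K K'.
Qed.

Lemma chart_bij A f : chart H A f -> set_bij setT A f.
Proof.
move=> [AH fA]; have [f0 [f0A f0inj f0surj] isoE] := apt_MA1 AH.
move: fA; rewrite isoE => -[w ww <-]; have [w' _ [wK w'K]] := Wa_inv ww.
split=> [v _|u v _ _ /= uv|p /f0surj[v _ <-]].
- exact: f0A.
- by apply: (can_inj wK); apply: f0inj => //; rewrite in_setT.
- by exists (w' v) => //=; rewrite w'K.
Qed.

Lemma chart_inj A f : chart H A f -> injective f.
Proof. by move=> /chart_bij[_ finj _] u v; apply: finj; rewrite in_setT. Qed.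

Lemma chart_in A f v : chart H A f -> A (f v).
Proof. by move=> /chart_bij[fA _ _]; apply: fA. Qed.

Lemma chart_onto A f p : chart H A f -> A p -> exists v, f v = p.
Proof. by move=> /chart_bij[_ _ fs] /fs[v _ <-]; exists v. Qed.

Lemma chart_change A f f' : chart H A f -> isomw H A f' ->
  exists2 w, Wa X w & f' = f \o w.
Proof.
move=> [AH]; have [f0 _ ->] := apt_MA1 AH => -[w ww <-] [w' ww' <-].
have [w1 ww1 [wK w1K]] := Wa_inv ww.
exists (w1 \o w'); first exact: gen_comp.
by apply/funext => v /=; rewrite w1K.
Qed.

Lemma cl_apt_mem A (F : set_system Delta) S :
  (forall S T, F S -> S `<=` T -> F T) -> cl_apt H A F S -> F S.
Proof.
move=> Fup [f _ [k [_ Fk kS]]]; apply: Fup Fk _ => _ [v vk <-]; exact: kS.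
Qed.

(** This is (MA2) for generic rays; unlike a germ at infinity it controls the ray from its origin
    on. *)
Lemma ray_transfer A f A' f' x u : chart H A f -> chart H A' f' -> generic_dir D u ->
  f @` vray x u `<=` A' ->
  exists2 w, Wa X w & forall v, vray x u v -> f v = f' (w v).
Proof.
move=> cA cA' ug rA'; have [MA2H _ _ _] := hovel.
pose F := fmap f (globally (vray x u)).
have FA' : F A' by move=> v vr; apply: rA'; exists v.
have Ff : in_apt H (MA2_filter X) A F.
  by exists f, (globally (vray x u)); split=> //; constructor 3; exists x, u.
have [_ [phi [_ phiE] [S SF phiS]]] := MA2H A A' F cA.1 cA'.1 Ff FA'.
have [w ww wE] := phiE f f' cA.2 cA'.2; exists w => // v vr.
rewrite -wE phiS //; have /cl_apt_mem : cl_apt H A F S by [].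
by apply=> // S1 T FS1 S1T z zr; apply: S1T; apply: FS1.
Qed.

(** Sector-faces whose enclosure can be described by frame roots alone. The wall condition is
    vacuous for sectors and puts a panel on a wall. *)
Definition wall_face s J b x :=
  [/\ frame D b, spherical D J, vface D s J (cone b J) & on_walls X b J x].

Lemma vface_generic s J F u : spherical D J -> vface D s J F -> F u -> u <> 0 ->
  generic_dir D u.
Proof.
move=> sJ [w ww FE] Fu u0; split=> //; move: Fu; rewrite FE => -[v vJ].
case: s {FE} => vu; [left|right]; rewrite /vlt_o ?subr0 ?sub0r; exists (w @` face0 D J);
  try by (exists J => //; exists w).
- by exists v.
- by exists v => //; rewrite -vu opprK.
Qed.

Definition sector_germ f b J x := fmap f (chimney_germ X (local_face x (cone b J)) (cone b J)).

Lemma sector_germ_up f b J x S T : sector_germ f b J x S -> S `<=` T ->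
  sector_germ f b J x T.
Proof.
move=> [xi xiF [k [ka kT kS]]] ST; exists xi => //; exists k; split=> //.
by move=> v /kS/ST.
Qed.

Section Pair.
Variables (A : set Delta) (f : V -> Delta) (A' : set Delta) (f' : V -> Delta).
Variables (s1 s2 : bool) (J1 J2 : {set I}) (b1 b2 : I -> 'Hom(V, R^o)) (x1 x2 : V).
Hypotheses (cA : chart H A f) (cA' : chart H A' f').
Hypotheses (W1 : wall_face s1 J1 b1 x1) (W2 : wall_face s2 J2 b2 x2).
Hypotheses (A1 : f @` trans x1 (cone b1 J1) `<=` A')
  (A2 : f @` trans x2 (cone b2 J2) `<=` A').

Let Rg := sector_germ f b1 J1 x1.
Let F := sector_germ f b2 J2 x2.

Let upRF S T : (Rg `&` F) S -> S `<=` T -> (Rg `&` F) T.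
Proof. by move=> [RS FS] ST; split; apply: sector_germ_up ST. Qed.

(** Under [wall_face] a chimney germ is both splayed and solid, so the two germs can play the two
    roles in (MA4). *)
Lemma pair_MA4 : cl_apt H A (Rg `&` F) (A `&` A') /\
  exists2 phi, apt_iso H (Wa X) A A' phi & fixes phi (cl_apt H A (Rg `&` F)).
Proof.
have [_ _ MA4H _] := hovel.
have [b1f sJ1 vF1 g1] := W1; have [b2f sJ2 vF2 g2] := W2.
have inA (B : set Delta) s J b x : wall_face s J b x -> f @` trans x (cone b J) `<=` B ->
    sector_germ f b J x B.
  move=> [bf _ _ gx] h; apply: chimney_germ_sub => // v vx.
  by apply: h; exists v.
have fA x b J : f @` trans x (cone b J) `<=` A by move=> _ [v _ <-]; apply: chart_in cA.
apply: MA4H; [|exact: cA.1|exact: cA'.1|exact: inA W1 _|exact: inA W2 _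
  |exact: inA W1 _|exact: inA W2 _].
split; exists A.
  exists f, (chimney_germ X (local_face x1 (cone b1 J1)) (cone b1 J1)); split=> //.
  exists x1, (cone b1 J1), (cone b1 J1); split=> //; first by exists s1, J1.
  by exists s1, J1.
right; exists f, (chimney_germ X (local_face x2 (cone b2 J2)) (cone b2 J2)); split=> //.
have vF : is_vface D (cone b2 J2) by exists s2, J2.
exists x2, (cone b2 J2), (cone b2 J2); split=> //.
exact: solid_face vF2.
Qed.

(** (MA4) only controls a subcone. A ray from [v] along the cone ends up in it, and two affine maps
    agreeing far out on that ray agree at [v]. *)
Let extend w y s J b x : Wa X w -> wall_face s J b x ->
  f @` trans x (cone b J) `<=` A' ->
  trans x (cone b J) y -> (forall v, trans y (cone b J) v -> f v = f' (w v)) ->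
  forall v, trans x (cone b J) v -> f v = f' (w v).
Proof.
move=> ww [bf sJ vF gx] xA' yx yE v vx.
have [u uF] := cone_neq0 J bf.
have vyJ j : j \in J -> (b j (v - y) : R) = 0.
  move: vx yx => [v1 v1F <-] [y1 y1F <-] jJ; have := v1F j; have := y1F j.
  by rewrite jJ => h1 h2; rewrite linearB !linearD /= h1 h2 addr0 subr0 subrr.
have [t0 t00 tF] := cone_absorb vyJ uF.
have tE t : t0 <= t -> trans y (cone b J) (v + t *: u).
  by move=> /tF h; exists (v - y + t *: u) => //; rewrite addrA [y + _]addrC subrK.
(* A zero direction is not generic, but then [v] is already in the subcone. *)
have [u0|/eqP u0] := eqVneq u 0.
  by apply: yE; have := tE t0 (lexx _); rewrite u0 scaler0 addr0.
have [|w1 ww1 w1E] := @ray_transfer A f A' f' v u cA cA' (vface_generic sJ vF uF u0).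
  move=> _ [_ [t tp ->] <-]; apply: xA'.
  have [->|tn] := eqVneq t 0; first by rewrite scale0r addr0; exists v.
  move: vx => [v1 v1F <-]; exists (x + v1 + t *: u) => //.
  exists (v1 + t *: u); last by rewrite addrA.
  by apply: coneD => //; apply: coneZ => //; rewrite lt_def tn.
have E t : t0 <= t -> w (v + t *: u) = w1 (v + t *: u).
  move=> tt; apply: (chart_inj cA'); rewrite -yE; last exact: tE.
  by rewrite w1E //; exists t => //; apply: le_trans tt; apply: ltW.
have [w0 [p [ww0 wE]]] := Wa_affine ww.
have [w10 [p1 [ww10 w1E']]] := Wa_affine ww1.
have v0 : vray v u v by exists 0; rewrite ?scale0r ?addr0.
rewrite w1E //; congr (f' _).
have := E t0 (lexx _); have := E (t0 + t0); rewrite lerDl ltW // => /(_ isT).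
rewrite !wE !w1E' !(Wv_add _ _ ww0) !(Wv_add _ _ ww10) !(Wv_scale _ _ ww0) !(Wv_scale _ _ ww10).
move: (w0 v) (w0 u) (w10 v) (w10 u) => a c a1 c1 e2 e1.
have E2 (z d q : V) : z + (t0 + t0) *: d + q = (z + t0 *: d + q) + t0 *: d.
  by rewrite scalerDl addrA [RHS]addrAC.
have e3 : t0 *: c1 = t0 *: c by move: e2; rewrite !E2 e1 => /addrI.
by apply: (addIr (t0 *: c)); rewrite -{1}e3 addrAC -e1 addrAC.
Qed.

(** The point is that a single [w] serves both sector-faces, so their relative position can be read
    in either apartment. *)
Lemma pair_transfer : exists w, [/\ Wa X w,
  forall v, trans x1 (cone b1 J1) v -> f v = f' (w v) &
  forall v, trans x2 (cone b2 J2) v -> f v = f' (w v)].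
Proof.
have [_ [phi [_ phiE] [S SRF phiS]]] := pair_MA4.
have [w ww wE] := phiE f f' cA.2 cA'.2.
have [RS FS] := cl_apt_mem upRF SRF.
have [b1f _ _ _] := W1; have [b2f _ _ _] := W2.
have [y1 y1F y1S] := chimney_germ_mem b1f RS.
have [y2 y2F y2S] := chimney_germ_mem b2f FS.
exists w; split=> //.
- apply: (extend ww W1 A1 y1F) => v vy.
  by rewrite -wE phiS //; apply: y1S.
- apply: (extend ww W2 A2 y2F) => v vy.
  by rewrite -wE phiS //; apply: y2S.
Qed.

End Pair.

(** (MA4) states the enclosure in a chart [f2] that may differ from [f]; the cones are carried over
    by the Weyl element relating the charts. *)
Lemma opposite_sectors_sub A f A' f' b s y z :
  chart H A f -> chart H A' f' ->
  wall_face s finset.set0 b y -> wall_face (~~ s) finset.set0 (fun i => - b i) z ->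
  f @` trans y (cone b finset.set0) `<=` A' ->
  f @` trans z (cone (fun i => - b i) finset.set0) `<=` A' ->
  A `<=` A'.
Proof.
move=> cA cA' W1 W2 A1 A2.
have [[f2 f2A [k [_ [k1 k2] kA]]] _] := pair_MA4 cA cA' W1 W2 A1 A2.
have [w ww f2E] := chart_change cA f2A.
have [w' ww' [wK w'K]] := Wa_inv ww.
have [w0 [p [ww0 w'E]]] := Wa_affine ww'.
have [b1f _ [w1 ww1 cE] _] := W1; have [b2f _ _ _] := W2.
have [y1 _ y1k] := chimney_germ_mem b1f k1; have [z1 _ z1k] := chimney_germ_mem b2f k2.
have vF : vface D s finset.set0 (w0 @` cone b finset.set0).
  exists (w0 \o w1); first exact: Wv_comp.
  rewrite cE; apply/seteqP; split=> [_ [_ [v vF <-] <-]|_ [v vF <-]].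
    by exists v => //; case: (s) => //=; rewrite (Wv_opp _ ww0).
  by exists (if s then w1 v else - w1 v); [exists v|case: (s) => //=; rewrite (Wv_opp _ ww0)].
have [b' b'f b'E] := vface_cone vF.
have kw v S : (f @^-1` (f2 @` S)) v -> S (w' v).
  by move=> [v' Sv']; rewrite f2E /= => /(chart_inj cA) <-; rewrite wK.
have kT : enclosed_set D k = setT.
  apply: (@enclosed_opposite_sectors _ _ _ _ b' k (w' y1) (w' z1) b'f); rewrite -b'E.
    move=> _ [_ [v vF' <-] <-]; have /kw := y1k _ (ex_intro2 _ _ v vF' erefl).
    by rewrite !w'E (Wv_add _ _ ww0) addrAC.
  move=> _ [_ [_ [v vF' <-] <-] <-].
  have nvF : cone (fun i => - b i) finset.set0 (- v).
    by move=> i; have := vF' i; rewrite inE opp_lfunE linearN opprK.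
  have /kw := z1k _ (ex_intro2 _ _ _ nvF erefl).
  by rewrite !w'E (Wv_add _ _ ww0) (Wv_opp _ ww0) addrAC.
move=> q /(chart_onto cA)[v <-].
have : (f2 @^-1` (A `&` A')) (w' v) by apply: kA; rewrite kT.
by rewrite f2E /= w'K => -[].
Qed.

(** A shortening may be witnessed in another apartment; [pair_transfer] pulls its translation vector
    back through the linear part of [w]. *)
Lemma sf_shortening_cone A f b J s x S' : chart H A f -> wall_face s J b x ->
  sf_shortening H (f @` trans x (cone b J)) S' ->
  exists y, [/\ S' = f @` trans y (cone b J), trans y (cone b J) `<=` trans x (cone b J) &
    wall_face s J b y].
Proof.
move=> cA W [A1 [f1 [x1 [F1 [xi [cA1 [s1 [J1 vF1]] F1xi SE ->]]]]]].
have [b1 b1f F1E] := vface_cone vF1.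
have SA1 : f @` trans x (cone b J) `<=` A1.
  by rewrite SE => _ [v _ <-]; apply: chart_in cA1.
have [w [ww wE _]] := pair_transfer cA cA1 W W SA1 SA1.
have [w0 [p [ww0 w0E]]] := Wa_affine ww.
have [w0' _ [w0K w0'K]] := Wv_inv ww0.
have E v : trans x (cone b J) v <-> trans x1 F1 (w v).
  split=> [vx|wv].
    have [z zx ze] : (f1 @` trans x1 F1) (f v) by rewrite -SE; exists v.
    by move: ze; rewrite wE // => /(chart_inj cA1) <-.
  have [z zx ze] : (f @` trans x (cone b J)) (f1 (w v)) by rewrite SE; exists (w v).
  have [w' _ [wK w'K]] := Wa_inv ww.
  by move: ze; rewrite wE // => /(chart_inj cA1)/(can_inj wK) <-.
pose y := x + w0' xi.
have wy v : w (y + v) = w (x + v) + xi.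
  rewrite !w0E !(Wv_add _ _ ww0) w0'K -!addrA; congr (_ + _).
  by rewrite addrC -addrA.
have yx : trans y (cone b J) `<=` trans x (cone b J).
  move=> _ [v vF <-]; apply/E; rewrite wy.
  have [v1 v1F <-] : trans x1 F1 (w (x + v)) by apply/E; exists v.
  exists (v1 + xi); last by rewrite addrA.
  by move: v1F F1xi; rewrite F1E; apply: coneD.
exists y; split=> //.
  apply/seteqP; split=> [_ [_ [v vF <-] <-]|_ [q qy <-]].
    have [w' _ [wK w'K]] := Wa_inv ww.
    have [v1 v1F v1E] : trans x (cone b J) (w' (x1 + v)).
      by apply/E; rewrite w'K; exists v.
    exists (y + v1); first by exists v1.
    rewrite wE; last by apply: yx; exists v1.
    by rewrite wy v1E w'K addrAC.
  have qx := yx _ qy; rewrite wE //; move: qy => [v vF <-].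
  have [v1 v1F v1E] : trans x1 F1 (w (x + v)) by apply/E; exists v.
  by exists (x1 + xi + v1); [exists v1|rewrite wy -v1E addrAC].
have [bf sJ vF gx] := W; split=> // j jJ.
have [u uF] := cone_neq0 J bf.
have [v vF' vE] : trans x (cone b J) (y + u) by apply: yx; exists u.
have := congr1 (b j) vE; rewrite [LHS]linearD [RHS]linearD /=.
have := vF' j; have := uF j; rewrite jJ => -> ->; rewrite !addr0 => <-.
exact: gx.
Qed.

(** Parallelism is witnessed in an auxiliary apartment; a common [w] brings the translation back to
    the chart [f]. *)
Lemma parallel_cones A f b1 J1 s1 x1 b2 J2 s2 x2 : chart H A f ->
  wall_face s1 J1 b1 x1 -> wall_face s2 J2 b2 x2 ->
  parallel H (sf_shortening H) (f @` trans x1 (cone b1 J1)) (f @` trans x2 (cone b2 J2)) ->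
  exists z, cone b2 J2 = trans z (cone b1 J1).
Proof.
move=> cA W1 W2 [A0 [f0 [S1 [S2 [u [cA0 [sh1 sh2] [S1A S2A] E]]]]]].
have [y1 [S1E _ Wy1]] := sf_shortening_cone cA W1 sh1.
have [y2 [S2E _ Wy2]] := sf_shortening_cone cA W2 sh2.
subst S1 S2; have [w [ww w1E w2E]] := pair_transfer cA cA0 Wy1 Wy2 S1A S2A.
have [w0 [p [ww0 wE]]] := Wa_affine ww; have [w0' _ [w0K w0'K]] := Wv_inv ww0.
have winj : injective w by have [w' _ [wK _]] := Wa_inv ww; apply: can_inj wK.
have tr v : w (w0' u + v) = u + w v.
  by rewrite !wE (Wv_add _ _ ww0) w0'K addrA.
exists (w0' u + y1 - y2); apply/seteqP; split=> [v vF|_ [v vF <-]].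
  have : (f0 @^-1` (f @` trans y2 (cone b2 J2))) (w (y2 + v)).
    by exists (y2 + v); [exists v|apply: w2E; exists v].
  rewrite E => -[q [_ [v1 v1F <-]]]; rewrite w1E; last by exists v1.
  move=> /(chart_inj cA0) <-; rewrite -tr => /winj e.
  by exists v1 => //; rewrite addrAC -[w0' u + _ + _]addrA e addrC addKr.
have : trans u (f0 @^-1` (f @` trans y1 (cone b1 J1))) (u + w (y1 + v)).
  exists (w (y1 + v)) => //; exists (y1 + v); [by exists v|].
  by apply: w1E; exists v.
rewrite -E => -[_ [v2 v2F <-]]; rewrite w2E; last by exists v2.
move=> /(chart_inj cA0); rewrite -tr => /winj e.
by rewrite addrAC -[w0' u + _ + _]addrA -e addrC addKr.
Qed.

End Transfer.

(** * Boundaries of apartments *)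

Section Boundary.
Variables (R : realType) (V : vectType R) (I : finType) (D : vect_data V I).
Variables (X : model_apartment D) (Delta : Type) (H : apt_system X Delta).
Implicit Types (A : set Delta) (f : V -> Delta) (b : I -> 'Hom(V, R^o)) (J : {set I}).

Lemma spherical0 : spherical D finset.set0.
Proof.
apply: (@sub_finite_set _ _ [set id]); last exact: finite_set1.
move=> w /gen_act[[|i s] sP ->] //=.
by have := sP i (mem_head _ _); rewrite /= inE.
Qed.

Lemma gen_group_srefl1 i w : gen_group [set srefl D j | j in [set` [set i]%SET]] w ->
  w = id \/ w = srefl D i.
Proof.
move=> /gen_act[s sP ->]; elim: s sP => [|j s IH] sP; first by left.
have -> : j = i by have := sP j (mem_head _ _); rewrite /= inE => /eqP.
have {}IH : act D s = id \/ act D s = srefl D i.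
  by apply: IH => k ks; apply: sP; rewrite inE ks orbT.
have -> : act D (i :: s) = srefl D i \o act D s by [].
by case: IH => ->; [right|left; apply/funext => v /=; rewrite sreflK].
Qed.

Lemma spherical1 i : spherical D [set i]%SET.
Proof.
apply: (@sub_finite_set _ _ ([set id] `|` [set srefl D i])).
  by move=> w /gen_group_srefl1[]; [left|right].
by rewrite finite_setU; split; exact: finite_set1.
Qed.

Lemma vface_face0 J : vface D true J (face0 D J).
Proof. by exists id; [exact: gen_id|rewrite image_id]. Qed.

Lemma vface_image w s J F : Wv D w -> vface D s J F -> vface D s J (w @` F).
Proof.
move=> ww [w1 ww1 ->]; exists (w \o w1); first exact: Wv_comp.
apply/seteqP; split=> [_ [_ [v vF <-] <-]|_ [v vF <-]].
  by exists v => //; case: s => //=; rewrite (Wv_opp _ ww).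
by exists (if s then w1 v else - w1 v); [exists v|case: s => //=; rewrite (Wv_opp _ ww)].
Qed.

Lemma chamber_wall_face s F : vface D s finset.set0 F ->
  exists2 b, F = cone b finset.set0 & forall x, wall_face X s finset.set0 b x.
Proof.
move=> vF; have [b bf FE] := vface_cone vF; exists b => // x.
by split=> //; [exact: spherical0|rewrite -FE|move=> j; rewrite inE].
Qed.

Lemma parallel_translates A f s J F x y : chart H A f -> vface D s J F ->
  parallel H (sf_shortening H) (f @` trans x F) (f @` trans y F).
Proof.
move=> cA vF; have [b bf FE] := vface_cone vF; have [xi xiF] := cone_neq0 J bf.
rewrite -FE in xiF.
exists A, f, (f @` trans (x + xi) F), (f @` trans (y + xi) F), (y - x); split=> //.
- by split; [exists A, f, x, F, xi|exists A, f, y, F, xi]; split=> //; exists s, J.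
- by split=> _ [v _ <-]; apply: chart_in cA.
apply/seteqP; split=> [v [_ [u uF <-]] /(chart_inj cA) <-|_ [v [_ [u uF <-]]] /(chart_inj cA) <- <-].
  exists (x + xi + u); last by rewrite !addrA subrK.
  by exists (x + xi + u) => //; exists u.
exists (y + xi + u); first by exists u.
by rewrite !addrA subrK.
Qed.

Lemma sph_sector_faceI A f s J F x : chart H A f -> spherical D J -> vface D s J F ->
  sph_sector_face H (f @` trans x F).
Proof. by move=> cA sJ vF; exists A, s, J; split=> //; exists f, x, F. Qed.

Lemma bface_translate A f s J F x y : chart H A f -> spherical D J -> vface D s J F ->
  bface H (f @` trans x F) (f @` trans y F).
Proof.
move=> cA sJ vF; split; first exact: sph_sector_faceI cA sJ vF.
exact: parallel_translates cA vF.
Qed.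

Lemma bdI A f s J F x : chart H A f -> spherical D J -> vface D s J F ->
  bd H A s (bface H (f @` trans x F)).
Proof. by move=> cA sJ vF; exists J => //; exists (f @` trans x F) => //; exists f, x, F. Qed.

Lemma sf_shortening_sub S S' : sf_shortening H S S' -> S' `<=` S.
Proof.
move=> [A [f [x [F [xi [cA [s [J vF]] Fxi -> ->]]]]]].
have [b bf FE] := vface_cone vF.
move=> _ [_ [v vF' <-] <-]; exists (x + xi + v) => //; exists (xi + v); last by rewrite addrA.
by move: Fxi vF'; rewrite FE; apply: coneD.
Qed.

Hypothesis hovel : ordered_affine_hovel H.

(** The translation between the parallel sectors is absorbed by moving deep enough into the open
    cone. *)
Lemma parallel_sector_sub A f A' s b x S' : chart H A f ->
  wall_face X s finset.set0 b x ->
  parallel H (sf_shortening H) (f @` trans x (cone b finset.set0)) S' -> S' `<=` A' ->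
  exists y, f @` trans y (cone b finset.set0) `<=` A'.
Proof.
move=> cA W [A0 [f0 [S1 [S2 [u [cA0 [sh1 sh2] [S1A0 S2A0] E]]]]]] SA'.
have [y1 [S1E _ W1]] := sf_shortening_cone hovel cA W sh1; subst S1.
have [w [ww wE _]] := pair_transfer hovel cA cA0 W1 W1 S1A0 S1A0.
have [w0 [p [ww0 w0E]]] := Wa_affine ww; have [w0' _ [w0K w0'K]] := Wv_inv ww0.
have tr v : w (w0' u + v) = u + w v by rewrite !w0E (Wv_add _ _ ww0) w0'K addrA.
have [bf _ _ _] := W; have [u0 u0F] := cone_neq0 finset.set0 bf.
have [j|t0 t00 tF] := @cone_absorb _ _ _ b finset.set0 (- w0' u) u0 _ u0F.
  by rewrite inE.
have t0u0F : cone b finset.set0 (t0 *: u0) by apply: coneZ.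
have t1F := tF t0 (lexx _).
exists (y1 + t0 *: u0) => _ [_ [v vF <-] <-].
apply/SA'/(sf_shortening_sub sh2).
have yF : trans y1 (cone b finset.set0) (y1 + t0 *: u0 + v).
  by exists (t0 *: u0 + v); [apply: coneD|rewrite addrA].
have -> : f (y1 + t0 *: u0 + v) = f0 (w (y1 + t0 *: u0 + v)) by apply: wE.
suff : (f0 @^-1` S2) (w (y1 + t0 *: u0 + v)) by [].
rewrite E; exists (w (y1 + (- w0' u + t0 *: u0 + v))).
  exists (y1 + (- w0' u + t0 *: u0 + v)).
    by exists (- w0' u + t0 *: u0 + v) => //; apply: coneD.
  by apply: wE; exists (- w0' u + t0 *: u0 + v) => //; apply: coneD.
rewrite -tr; congr (w _).
by rewrite [LHS]addrCA -(addrA (- w0' u)) addNKr addrA.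
Qed.

Definition boundary_covered (g : Delta -> Delta) A :=
  forall s c, bd H A s c -> exists2 c1, bd H A s c1 & bact g c1 = c.

Lemma vface_neg J : vface D false J (cone (fun i => - sroot D i) J).
Proof.
exists id; first exact: gen_id.
have N v : cone (fun i => - sroot D i) J v <-> face0 D J (- v).
  split=> vF i; have := vF i; rewrite opp_lfunE linearN //.
apply/seteqP; split=> [v /N vF|_ [v vF <-]]; first by exists (- v); rewrite ?opprK.
by apply/N; rewrite opprK.
Qed.

(** Each ideal chamber of [A] is the image of one of [A], so it has a representative in [A']. Two
    opposite chambers then suffice. *)
Lemma chart_sub_of_boundary A A' (g : Delta -> Delta) : apts H A -> apts H A' ->
  (forall S, S `<=` A -> g @` S `<=` A') -> boundary_covered g A -> A `<=` A'.
Proof.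
move=> AH A'H gA gbd.
have [f0 f0b isoA] := apt_MA1 AH; have [f0' f0'b isoA'] := apt_MA1 A'H.
have cA : chart H A f0 by split=> //; rewrite isoA; exists id => //; apply: gen_id.
have cA' : chart H A' f0' by split=> //; rewrite isoA'; exists id => //; apply: gen_id.
have key s b : vface D s finset.set0 (cone b finset.set0) -> frame D b ->
    exists y, f0 @` trans y (cone b finset.set0) `<=` A'.
  move=> vF bf.
  have W : wall_face X s finset.set0 b 0.
    by split=> //; [exact: spherical0|move=> j; rewrite inE].
  have [c1 [J sJ [S1 S1f ->]] c1E] := gbd s _ (bdI 0 cA spherical0 vF).
  have S1A : S1 `<=` A.
    by move: S1f => [f1 [x1 [F1 [c1A vF1 ->]]]] _ [v _ <-]; apply: chart_in c1A.
  have S1S1 : bface H S1 S1.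
    by move: S1f => [f1 [x1 [F1 [c1A vF1 ->]]]]; apply: (bface_translate _ _ c1A sJ vF1).
  have [_ par] : bface H (f0 @` trans 0 (cone b finset.set0)) (g @` S1).
    by rewrite -c1E; exists S1.
  exact: parallel_sector_sub cA W par (gA _ S1A).
have [y yA] := key true _ (vface_face0 finset.set0) (frame_sroot D).
have nf : frame D (fun i => - sroot D i).
  split=> [j|c]; first by apply: real_rootN; apply: (frame_sroot D).1.
  have [v vE] := (frame_sroot D).2 (fun i => - c i); exists v => j.
  by rewrite opp_lfunE vE opprK.
have [z zA] := key false _ (vface_neg finset.set0) nf.
apply: (@opposite_sectors_sub _ _ _ _ X _ H hovel A f0 A' f0' (sroot D) true y z) => //.
  by split=> //; [exact: frame_sroot|exact: spherical0|exact: vface_face0|move=> j; rewrite inE].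
by split=> //; [exact: spherical0|exact: vface_neg|move=> j; rewrite inE].
Qed.

(* Letting [t] go to infinity in [w (t v) \in z + face0 J] shows that [w v] is
   dominant. *)
Lemma face0_translate_stab w J z : Wv D w -> w @` face0 D J = trans z (face0 D J) ->
  gen_group [set srefl D j | j in [set` J]] w.
Proof.
move=> ww wE; have [v vF] := cone_neq0 J (frame_sroot D).
have vdom : dominant D v by move=> i; have := vF i; case: ifP => [_ ->|_ /ltW].
have <- : [set i | (sroot D i v : R) = 0] = [set` J].
  apply/seteqP; split=> i /=; have := vF i; case: ifP => // _.
  by move=> h h'; move: h; rewrite h' ltxx.
apply: dominant_orbit => // i; rewrite leNgt; apply/negP => wvi.
have ge t : 0 < t -> (sroot D i z : R) <= t * (sroot D i (w v) : R).
  move=> t0; have [u uF uE] : trans z (face0 D J) (w (t *: v)).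
    by rewrite -wE; exists (t *: v) => //; apply: coneZ.
  have := congr1 (sroot D i) uE; rewrite (Wv_scale _ _ ww) linearD linearZ /= => e.
  have -> : t * (sroot D i (w v) : R) = (sroot D i z : R) + sroot D i u by [].
  by rewrite lerDl; have := uF i; case: ifP => [_ ->|_ /ltW].
pose t := (1 + `|sroot D i z : R|) / - (sroot D i (w v) : R).
have wvi' : 0 < - (sroot D i (w v) : R) by rewrite oppr_gt0.
have := ge t; rewrite divr_gt0 ?ltr_pwDl // => /(_ isT).
have -> : t * (sroot D i (w v) : R) = - (1 + `|sroot D i z : R|).
  by rewrite /t -[X in _ * X]opprK mulrN divfK // gt_eqF.
have := ler_norm (- (sroot D i z : R)); rewrite normrN; lra.
Qed.

End Boundary.

(** * The affine action of the stabilizer of an apartment *)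

Section GroupAction.
Variables (R : realType) (V : vectType R) (I : finType) (D : vect_data V I).
Variables (X : model_apartment D) (Delta : Type) (H : apt_system X Delta).
Variable G : set (Delta -> Delta).
Hypothesis hovel : ordered_affine_hovel H.
Hypothesis sd : semi_discrete X.
Hypothesis Gvw : vect_weyl_subgroup H G.
Hypothesis Gst : strongly_transitive_bd H G.
Hypothesis Glst : LST H G.
Variables (A : set Delta) (f : V -> Delta).
Hypothesis cA : chart H A f.

Lemma G_inv g : G g -> exists2 h, G h & cancel g h /\ cancel h g.
Proof. by case: Gvw => _ _ + _; apply. Qed.

Lemma G_comp g h : G g -> G h -> G (g \o h).
Proof. by case: Gvw => _ + _ _; apply. Qed.

Lemma G_apt g B : G g -> apts H B -> apts H (g @` B).
Proof. by case: Gvw => _ _ _ h /h[[_ + _] _] BH => /(_ B) <-. Qed.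

Lemma G_stab_affine g : G g -> g @` A = A -> exists w t, [/\ Wv D w,
  forall v, g (f v) = f (w v + t) & AutA X (fun v => w v + t)].
Proof.
move=> Gg gA; case: Gvw => _ _ _ /(_ g Gg)[_ /(_ A cA.1)]; rewrite gA => -[_ /(_ f f cA.2 cA.2)].
move=> [w' [w'A [w [t [ww w'E]]]] gE]; exists w, t; split=> //.
  by move=> v; rewrite gE w'E.
by have -> : (fun v => w v + t) = w' by apply/funext => v; rewrite w'E.
Qed.

Lemma bact_comp (g h : Delta -> Delta) c : cancel h g -> bact g (bact h c) = c.
Proof.
move=> hK; have K S : g @` (h @` S) = S.
  apply/seteqP; split=> [_ [_ [p pS <-] <-]|p pS]; first by rewrite hK.
  by exists (h p) => //; exists p.
apply/seteqP; split=> [_ [_ [S Sc <-] <-]|S Sc]; first by rewrite K.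
by exists (h @` S); [exists S|rewrite K].
Qed.

(** One inclusion comes from [g], the other from its inverse. *)
Lemma G_stab_of_boundary g : G g -> (forall s, [set bact g c | c in bd H A s] = bd H A s) ->
  g @` A = A.
Proof.
move=> Gg gbd; have [h Gh [gK hK]] := G_inv Gg.
have sub k : G k -> boundary_covered H k A -> A `<=` k @` A.
  move=> Gk; apply: (chart_sub_of_boundary hovel cA.1 (G_apt Gk cA.1)).
  by move=> S SA; apply: image_subset.
apply/seteqP; split; last first.
  by apply: sub => // s c; rewrite -{1}gbd => -[c1 c1A <-]; exists c1.
have hA : A `<=` h @` A.
  apply: sub => // s c cb; exists (bact g c); last exact: bact_comp.
  by rewrite -gbd; exists c.
by move=> _ [p /hA[q qA <-] <-]; rewrite hK.
Qed.

(** Move the ideal chamber of the fundamental chamber to that of its image under [r_i]. If [w] is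
    the linear part, [r_i w] preserves the fundamental chamber up to translation, so it is the
    identity. *)
Lemma G_reflection i : exists g t, G g /\ forall v, g (f v) = f (srefl D i v + t).
Proof.
have ri : Wv D (srefl D i) by apply: gen_in; exists i.
have vC := vface_face0 D finset.set0; have vrC := vface_image ri vC.
have [||g [Gg gbd gc]] := Gst.2 A (bface H (f @` trans 0 (face0 D finset.set0)))
    (bface H (f @` trans 0 (srefl D i @` face0 D finset.set0))) cA.1.
- by eexists; last by []; exists f, 0, (face0 D finset.set0).
- by eexists; last by []; exists f, 0, (srefl D i @` face0 D finset.set0).
have [w [t [ww gE _]]] := G_stab_affine Gg (G_stab_of_boundary Gg gbd).
have vwC := vface_image ww vC.
have gC : g @` (f @` trans 0 (face0 D finset.set0)) = f @` trans t (w @` face0 D finset.set0).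
  apply/seteqP; split=> [_ [_ [_ [v vC' <-] <-] <-]|_ [_ [_ [v vC' <-] <-] <-]].
    by rewrite add0r gE addrC; exists (t + w v) => //; exists (w v) => //; exists v.
  by rewrite addrC -gE; exists (f v) => //; exists v => //; exists v; rewrite ?add0r.
have [_ par] : bface H (f @` trans 0 (srefl D i @` face0 D finset.set0))
    (f @` trans t (w @` face0 D finset.set0)).
  by rewrite -gc -gC; exists (f @` trans 0 (face0 D finset.set0)) => //;
     apply: bface_translate cA (spherical0 D) vC.
have [b1 b1E W1] := chamber_wall_face X vrC; have [b2 b2E W2] := chamber_wall_face X vwC.
have [|z zE] := parallel_cones hovel cA (W1 0) (W2 t); first by rewrite -b1E -b2E.
exists g, t; split=> // v; rewrite gE; congr (f (_ + _)).
rewrite -b1E -b2E in zE.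
have wi : Wv D (srefl D i \o w) by apply: Wv_comp.
have /gen_act[s sP sE] : gen_group [set srefl D j | j in [set` finset.set0 : {set I}]]
    (srefl D i \o w).
  apply: (@face0_translate_stab _ _ _ _ _ _ (srefl D i z)) => //.
  rewrite -image_comp zE; apply/seteqP; split=> [_ [_ [_ [u uC <-] <-] <-]|_ [u uC <-]].
    by rewrite (Wv_add _ _ ri) sreflK; exists u.
  exists (z + srefl D i u); last by rewrite (Wv_add _ _ ri) sreflK.
  by exists (srefl D i u) => //; exists u.
have {}sE : srefl D i \o w = id.
  by case: s sP sE => // j s /(_ j (mem_head _ _)); rewrite /= inE.
by rewrite -[LHS](sreflK D i) -[srefl D i (w v)]/((srefl D i \o w) v) sE.
Qed.

(** Levels [k < l] produce the level [2 l - 2 k], so isolation at 0 bounds all gaps below and the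
    infimum of the positive levels is attained. *)
Lemma Lam_gap a : real_root D a ->
  exists2 lam : R, 0 < lam & Lam X a lam /\ forall m, Lam X a m -> 0 < m -> lam <= m.
Proof.
move=> ra; have L0 := Lam0 X ra.
have [U U0 [_ UL]] : exists2 U, nbhs (0 : R) U & True /\ forall m, Lam X a m -> U m -> m = 0.
  have [_ [U U0 UE]] := sd ra L0; exists U => //; split=> // m am Um.
  have : [set 0 : R] m by rewrite -UE.
  by [].
have /nbhs_ballP[e /= e0 eU] := U0.
have gap k l : Lam X a k -> Lam X a l -> k < l -> e <= 2 * (l - k).
  move=> ak al kl; rewrite leNgt; apply/negP => lte.
  have : Lam X a (2 * l - 2 * k).
    have := Lam_refl ra al (Lam_refl ra ak L0); congr (Lam X a _); ring.
  move=> /UL h; have : 2 * l - 2 * k = 0.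
    apply/h/eU; rewrite /ball /= sub0r normrN ger0_norm; lra.
  lra.
pose P := [set m | Lam X a m /\ 0 < m].
have [p ap p0] := Lam_large X 0 ra.
have Pp : P p by split.
have Pinf : has_inf P by split; [exists p|exists 0 => m [_ /ltW]].
have e4 : 0 < e / 4 by rewrite divr_gt0.
have [l [al l0] lt] := inf_adherent e4 Pinf.
exists l => //; split=> // m am m0; rewrite leNgt; apply/negP => ml.
have := gap _ _ am al ml; have : inf P <= m by apply: ge_inf => //; exact: Pinf.2.
lra.
Qed.

(** The automorphism carries the wall [alpha_i = 0] to a wall through [t], which turns out to be a
    level set of [b i]. *)
Lemma panel_wall_face i w t : Wv D w -> AutA X (fun v => w v + t) ->
  exists2 b, w @` face0 D [set i]%SET = cone b [set i]%SET &
             wall_face X true [set i]%SET b t.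
Proof.
move=> ww [_ [L [t' [gE gP]]]]; have vF := vface_image ww (vface_face0 D [set i]%SET).
have [b bf FE] := vface_cone vF; exists b => //.
split=> //; [exact: spherical1|by rewrite -FE|move=> j; rewrite inE => /eqP ->].
have [u uF] := cone_neq0 [set i]%SET (frame_sroot D).
have wuF : cone b [set i]%SET (w u) by rewrite -FE; exists u.
(* Both kernels are spanned by the panels, which correspond under [w]. *)
have bi v : (b i (w v) : R) = 0 <-> (sroot D i v : R) = 0.
  split=> [bv|av].
    have [l|t0 t00 /(_ _ (lexx _))] := @cone_absorb _ _ _ b [set i]%SET (w v) (w u) _ wuF.
      by rewrite inE => /eqP ->.
    rewrite -(Wv_scale _ _ ww) -(Wv_add _ _ ww) -FE => -[v' v'F].
    have [w' _ [wK _]] := Wv_inv ww.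
    move=> /(can_inj wK) v'E; have := v'F i; rewrite inE eqxx v'E linearD linearZ /=.
    by have := uF i; rewrite inE eqxx => ->; rewrite scaler0 addr0.
  have [l|t0 t00 /(_ _ (lexx _)) vuF] := @cone_absorb _ _ _ (sroot D) [set i]%SET v u _ uF.
    by rewrite inE => /eqP ->.
  have : cone b [set i]%SET (w (v + t0 *: u)) by rewrite -FE; exists (v + t0 *: u).
  move=> /(_ i); have := wuF i; rewrite inE eqxx (Wv_add _ _ ww) (Wv_scale _ _ ww).
  by rewrite linearD linearZ /= => ->; rewrite scaler0 addr0.
have ai : real_root D (sroot D i) by apply: (frame_sroot D).1.
have [M _] := gP (hyp (sroot D i) 0) (scoroot D i).
have [|a [k [_ ak Me]]] := M.
  exists (sroot D i), 0; split=> //; last exact: Lam0.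
  by exists id, i; split=> //; apply: gen_id.
rewrite /Lam /=; have -> : hyp (b i) (- (b i t : R)) = hyp a k; last by [].
rewrite -Me; apply/seteqP; split=> [v vh|_ [v vh <-]].
  have [w' _ [wK w'K]] := Wv_inv ww.
  exists (w' (v - t)); last by rewrite w'K subrK.
  rewrite /hyp /= addr0; apply/bi; rewrite w'K linearB /=.
  by move: vh; rewrite /hyp /=.
move: vh; rewrite /hyp /= addr0 => /bi bv.
by rewrite linearD /= bv add0r subrr.
Qed.

(** [A] is the union of the fibres over its line in the tree. *)
Lemma tree_stab_apt sg sg' g i :
  tree_apt H sg sg' A ->
  (forall v, fibre H sg sg' A (f @` hyp (sroot D i) (- (sroot D i v : R)))) ->
  bact g (tree_line H sg sg' A) = tree_line H sg sg' A -> g @` A = A.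
Proof.
move=> tA fib gD.
have fibA L : tree_line H sg sg' A L -> L `<=` A.
  move=> [_ [_ [f1 [a [t [f1A _ ->]]]]]] _ [v _ <-].
  by have c1 : chart H A f1 by [split=> //; exact: cA.1]; exact: chart_in c1.
have mem v : (f @` hyp (sroot D i) (- (sroot D i v : R))) (f v).
  by exists v => //; rewrite /hyp /= subrr.
apply/seteqP; split=> [_ [p /(chart_onto cA)[v <-] <-]|p /(chart_onto cA)[v <-]].
  have : tree_line H sg sg' A (g @` (f @` hyp (sroot D i) (- (sroot D i v : R)))).
    by rewrite -gD; eexists; last by []; exact: fib.
  by move=> /fibA; apply; exists (f v).
have := fib v; rewrite -[fibre _ _ _ _ _]/(tree_line H sg sg' A _) -gD => -[L LD LE].
have := mem v; rewrite -LE => -[q qL <-]; exists q => //.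
exact: (fibA L LD).
Qed.

Lemma G_translation i : exists g t, [/\ G g, forall v, g (f v) = f (v + t) &
  (sroot D i t : R) != 0].
Proof.
pose al := sroot D i; pose F := face0 D [set i]%SET.
have ra : real_root D al by apply: (frame_sroot D).1.
have [lam lam0 [alam lmin]] := Lam_gap ra.
have vF : vface D true [set i]%SET F := vface_face0 D _.
have vnF : vface D false [set i]%SET [set - v | v in F].
  by exists id; [exact: gen_id|].
have sph := spherical1 D i.
pose sg := bface H (f @` trans 0 F); pose sg' := bface H (f @` trans 0 [set - v | v in F]).
have opp : opposite_panels H sg sg'.
  exists [set i]%SET; first by rewrite cards1.
  by exists A, f, true, F, 0, 0.
have tA : tree_apt H sg sg' A.
  split; first exact: cA.1.
    by exists true; apply: bdI cA sph vF.
  by exists false; apply: bdI cA sph vnF.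
have inf x : at_infinity sg sg' (f @` hyp al (- (al x : R))).
  split; [exists (f @` trans x F)|exists (f @` trans x [set - v | v in F])].
  - exact: bface_translate cA sph vF.
  - move=> _ [_ [v vF' <-] <-]; exists (x + v) => //.
    by have := vF' i; rewrite inE eqxx /hyp /= linearD /= => ->; rewrite addr0 subrr.
  - exact: bface_translate cA sph vnF.
  - move=> _ [_ [_ [v vF' <-] <-] <-]; exists (x - v) => //.
    by have := vF' i; rewrite inE eqxx /hyp /= linearB /= => ->; rewrite subr0 subrr.
have fib v : fibre H sg sg' A (f @` hyp al (- (al v : R))).
  by split=> //; split=> //; exists f, al, (- (al v : R)); split=> //; exact: cA.2.
(* Edges of length [lam] starting at the levels [2 n lam], which are reached from 0 by translations
   of [Lam]. *)
pose E n := [set f @` hyp al t | t in [set t : R | n%:R * (2 * lam) <= t /\ t <= n%:R * (2 * lam) + lam]].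
have LamE n m : Lam X al m -> Lam X al (n%:R * (2 * lam) + m).
  by move=> am; have := Lam_trans n ra alam am; rewrite -mulr_natl addrC.
have edgeE n : edge_of H sg sg' (tree_line H sg sg' A) (E n).
  exists A; split=> //; split=> //.
  exists f, al, (n%:R * (2 * lam)), (n%:R * (2 * lam) + lam); split=> //.
  - exact: cA.2.
  - have [x xE] := (frame_sroot D).2 (fun=> - (n%:R * (2 * lam))).
    by have := inf x; rewrite xE opprK.
  - split; [|exact: LamE|lra|].
      by rewrite -[n%:R * _]addr0; apply: LamE; apply: Lam0.
    move=> m am [m1 m2].
    have nm := LamE n _ (LamN ra am).
    have := LamN ra nm; rewrite opprD opprK addrC => /lmin; lra.
have [_ edge_trans] := Glst opp.
have lineA : tree_lines H sg sg' (tree_line H sg sg' A) by exists A.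
have step n : exists g w t, [/\ G g, w = id \/ w = srefl D i, forall v, g (f v) = f (w v + t) &
    n%:R * (2 * lam) <= - (al t : R) /\ - (al t : R) <= n%:R * (2 * lam) + lam].
  have [g [[Gg gsg gsg'] gD gE]] := edge_trans _ _ _ lineA (edgeE 0%N) (edgeE n).
  have gA := tree_stab_apt tA fib gD.
  have [w [t [ww wE aut]]] := G_stab_affine Gg gA.
  have wF : w = id \/ w = srefl D i.
    have gF : g @` (f @` trans 0 F) = f @` trans t (w @` F).
      apply/seteqP; split=> [_ [_ [_ [v vC' <-] <-] <-]|_ [_ [_ [v vC' <-] <-] <-]].
        by rewrite add0r wE addrC; exists (t + w v) => //; exists (w v) => //; exists v.
      by rewrite addrC -wE; exists (f v) => //; exists v => //; exists v; rewrite ?add0r.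
    have [_ par] : sg (f @` trans t (w @` F)).
      by rewrite -gsg -gF; exists (f @` trans 0 F) => //; apply: bface_translate cA sph vF.
    have [b bE W] := panel_wall_face i ww aut.
    have W0 : wall_face X true [set i]%SET (sroot D) 0.
      split=> //; first exact: frame_sroot.
      move=> j; rewrite inE => /eqP ->; rewrite linear0 oppr0; exact: Lam0.
    have [|z zE] := parallel_cones hovel cA W0 W; first by rewrite -bE.
    apply: (@gen_group_srefl1 _ _ _ D i); apply: (@face0_translate_stab _ _ _ _ _ _ z) => //.
    by rewrite bE zE.
  exists g, w, t; split=> //.
  (* The wall of level 0 belongs to [E 0]; its image passes through [f t] and belongs to [E n]. *)
  have : E n (g @` (f @` hyp al 0)).
    rewrite -gE; exists (f @` hyp al 0) => //; exists 0 => //=.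
    by rewrite mul0r; split=> //; rewrite add0r ltW.
  move=> [tau [tau1 tau2] tauE].
  have : (f @` hyp al tau) (f t).
    rewrite tauE; exists (f 0); last by rewrite wE; congr f; case: wF => ->; rewrite ?add0r //;
      rewrite /srefl linear0 scale0r subr0 add0r.
    by exists 0 => //; rewrite /hyp /= linear0 addr0.
  move=> [v vh /(chart_inj cA) vt]; move: vh; rewrite vt /hyp /= => vh.
  by have -> : - (al t : R) = tau by lra.
(* For these two edges, [- alpha_i(t1)] is at most [3 lam] and [- alpha_i(t2)] at least [4 lam]. So
   if both linear parts are [r_i], the composite translates by a vector on which [alpha_i] is at
   least [lam]. *)
have [g1 [w1 [t1 [G1 w1E g1E [b1 b1']]]]] := step 1%N.
have [g2 [w2 [t2 [G2 w2E g2E [b2 b2']]]]] := step 2%N.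
have ri : Wv D (srefl D i) by apply: gen_in; exists i.
case: w1E => w1E; subst w1.
  by exists g1, t1; split=> //; rewrite lt_eqF // -/al; lra.
case: w2E => w2E; subst w2.
  by exists g2, t2; split=> //; rewrite lt_eqF // -/al; lra.
exists (g1 \o g2), (srefl D i t2 + t1); split; first exact: G_comp.
  by move=> v; rewrite /= g2E g1E (Wv_add _ _ ri) sreflK -addrA.
rewrite linearD /= srefl_root gt_eqF // -/al; lra.
Qed.

(** * The group of induced translations *)

Definition translation t := exists2 g, G g & forall v, g (f v) = f (v + t).

Lemma translation0 : translation 0.
Proof. by exists id => [|v]; [case: Gvw|rewrite addr0]. Qed.

Lemma translationD t u : translation t -> translation u -> translation (t + u).
Proof.
move=> [g Gg gE] [h Gh hE]; exists (g \o h) => [|v]; first exact: G_comp.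
by rewrite /= hE gE addrAC addrA.
Qed.

Lemma translationN t : translation t -> translation (- t).
Proof.
move=> [g Gg gE]; have [h Gh [gK hK]] := G_inv Gg; exists h => // v.
by rewrite -[LHS](congr1 h (congr1 f (subrK t v))) -gE gK.
Qed.

Lemma translationMz t (n : int) : translation t -> translation (t *~ n).
Proof.
move=> Tt; have Tn m : translation (t *+ m).
  elim: m => [|m IH]; first by rewrite mulr0n; exact: translation0.
  by rewrite mulrS; apply: translationD.
by case: n => m; [exact: Tn|rewrite NegzE mulrNz; apply/translationN/Tn].
Qed.

Lemma translation_sum (F : I -> V) : (forall i, translation (F i)) -> translation (\sum_i F i).
Proof. by move=> h; elim/big_ind: _ => //; [exact: translation0|exact: translationD]. Qed.

Lemma translation_coroot i :
  exists2 c : R, c != 0 & translation (c *: scoroot D i).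
Proof.
have [g0 [t [Gg0 g0E tn0]]] := G_translation i.
have [g [p [Gg gE]]] := G_reflection i.
have [h Gh [gK hK]] := G_inv Gg.
exists (sroot D i t : R) => //.
have -> : (sroot D i t : R) *: scoroot D i = t - srefl D i t.
  by rewrite /srefl opprB addrC subrK.
apply: translationD; first by exists g0.
(* Conjugation by an element with linear part [r_i] turns the translation by [t] into that by
   [r_i t]. *)
apply: translationN; exists (g \o g0 \o h); first by apply: G_comp => //; apply: G_comp.
have ri : Wv D (srefl D i) by apply: gen_in; exists i.
have hE v : h (f v) = f (srefl D i (v - p)).
  by rewrite -[LHS](congr1 h (congr1 f (subrK p v))) -[v - p in LHS](sreflK D i) -gE gK.
by move=> v; rewrite /= hE g0E gE (Wv_add _ _ ri) sreflK addrAC subrK.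
Qed.

End GroupAction.

(** * Rounding, and the hyperbolic element *)

Lemma lattice_approx (R : realType) (I : finType) (M : I -> I -> R) (x c : I -> R) :
  (forall i, c i != 0) -> (forall j, 0 < \sum_i x i * M i j) ->
  exists n : I -> int, forall j, 0 < \sum_i (n i)%:~R * c i * M i j.
Proof.
move=> c0 xP; pose K j := \sum_i `|c i * M i j|; pose d j := \sum_i x i * M i j.
(* Rounding costs at most [K j] in the coordinate [j]; scaling [x] by [N] makes every [N * d j]
   exceed this. *)
pose N := 1 + \sum_j K j / d j.
have K0 j : 0 <= K j by apply: sumr_ge0.
have NP j : K j < N * d j.
  rewrite -ltr_pdivrMr ?xP // /N (bigD1 j) //= addrCA ltrDl ltr_pwDl // sumr_ge0 // => l _.
  by rewrite divr_ge0 // ltW // xP.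
exists (fun i => Num.floor (N * x i / c i)) => j.
have : \sum_i (N * (x i * M i j) - `|c i * M i j|) <=
       \sum_i (Num.floor (N * x i / c i))%:~R * c i * M i j.
  apply: ler_sum => i _; set y := N * x i / c i; set z := (Num.floor y)%:~R : R.
  have z1 : z <= y by apply: Num.Theory.ge_floor.
  have z2 : y < z + 1 by have := Num.Theory.floorD1_gt y; rewrite intrD.
  have -> : N * (x i * M i j) = y * (c i * M i j) by rewrite mulrA -[N * x i](divfK (c0 i)) mulrA.
  rewrite -[z * _ * _]mulrA; set q := c i * M i j.
  have := ler_norm q; have := ler_norm (- q); rewrite normrN => q1 q2.
  nra.
apply: lt_le_trans; rewrite big_split /= -mulr_sumr sumrN subr_gt0; exact: NP.
Qed.

Theorem theorem6p2 (R : realType) (V : vectType R) (I : finType)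
    (D : vect_data V I) (X : model_apartment D)
    (Delta : Type) (H : apt_system X Delta) (G : set (Delta -> Delta)) :
  ordered_affine_hovel H ->
  thick H ->
  semi_discrete X ->
  no_affine_factor D ->
  (2 <= \dim {:V})%N ->
  vect_weyl_subgroup H G ->
  strongly_transitive_bd H G ->
  LST H G ->
  exists2 gamma, G gamma & strongly_regular_hyperbolic H gamma.
Proof.
move=> hovel _ sd na _ Gvw Gst Glst.
case: (apt_nonempty H) => p; have [A AH _] := apt_cover H p.
have [f fb isoE] := apt_MA1 AH.
have cA : chart H A f by split=> //; rewrite isoE; exists id => //; apply: gen_id.
have [x xP] := no_affine_factor_pos na.
have /choice[c cP] : forall i, exists c : R,
    c != 0 /\ translation G f (c *: scoroot D i).
  by move=> i; have [c c0 cT] := translation_coroot hovel sd Gvw Gst Glst cA i; exists c.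
have [n nP] := lattice_approx (fun i => (cP i).1) xP.
pose b := \sum_i (c i *: scoroot D i) *~ n i.
have [g Gg gE] : translation G f b.
  by apply: (translation_sum Gvw) => i; apply: (translationMz Gvw); apply: (cP i).2.
have bC : face0 D finset.set0 b.
  move=> j; rewrite inE /b linear_sum /=; have := nP j; congr (_ < _).
  apply: eq_bigr => i _; rewrite [RHS]raddfMz /= -mulrA -[RHS]mulrzl; congr (_ * _).
  by rewrite linearZ.
have [i0 _] : exists i : I, true by have /card_gt0P[i _] := index_nonempty D; exists i.
have b0 : b <> 0.
  by move=> b0; have := bC i0; rewrite inE b0 linear0 ltxx.
exists g => //; split; first by case: Gvw => _ _ _ /(_ g Gg)[].
(* The axis passes through [f 0] with direction [b] in the open chamber, and [g] shifts its
   parameter by 1. *)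
exists A, f, 0, b; split=> //.
- exists (bface H (f @` trans 0 (face0 D finset.set0))),
    (bface H (f @` trans 0 [set - v | v in face0 D finset.set0])); split.
  + exists A, f, true, (face0 D finset.set0), 0, 0; split=> //.
    * exact: spherical0.
    * exact: vface_face0.
  + by exists A, f, 0, true, (face0 D finset.set0), b; split=> //; exact: vface_face0.
  + exists A, f, 0, false, [set - v | v in face0 D finset.set0], (- b); split=> //.
      by exists id; [exact: gen_id|].
    by exists b.
- apply/seteqP; split=> [_ [_ [_ [t ->] <-] <-]|_ [_ [t ->] <-]].
    rewrite gE; exists (0 + t *: b + b) => //; exists (t + 1).
    by rewrite scalerDl scale1r addrA.
  exists (f (0 + (t - 1) *: b)); first by exists (0 + (t - 1) *: b) => //; exists (t - 1).
  by rewrite gE scalerBl scale1r addrA subrK.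
- exists 1; first by apply/eqP; rewrite oner_eq0.
  by move=> t; rewrite gE scalerDl scale1r addrA.
Qed.
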